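(* Let $\Omega\subset\mathbb{R}^N$ be a smooth bounded domain, let $f$ be a nonnegative, not identically zero, bounded Hölder continuous function on $\Omega$, and let $F$ be either a regular or a singular nonlinearity. Then $$\lambda^*(\Omega,f)\ \le\ \lambda_1(\Omega)\,\min\left\{\frac{B_F}{\inf_\Omega f},\ \frac{C_F}{\int_\Omega f\phi_\Omega\,dx}\right\}.$$
   Context: A nonlinearity $F$ is a smooth, increasing, convex function on its domain $D_F=[0,a_F)$ with $F(0)=1$. It is called regular if $a_F=+\infty$ and $F$ is superlinear (i.e. $F(u)/u\to\infty$ as $u\to\infty$), and singular if $a_F=1$ and $\lim_{u\nearrow1}F(u)=+\infty$. Put $B_F:=\sup_{\tau\in(0,a_F)}\frac{\tau}{F(\tau)}$ and $C_F:=\int_0^{a_F}\frac{d\tau}{F(\tau)}$. For $\lambda>0$ let $(P_{\lambda,f})$ be the problem $-\Delta u=\lambda f(x)F(u)$ in $\Omega$, $u=0$ on $\partial\Omega$. A solution $u$ is classical if $\|u\|_{L^\infty}<\infty$ ($F$ regular), resp. $\|u\|_{L^\infty}<1$ ($F$ singular). The extremal parameter is $\lambda^*(\Omega,f):=\sup\{\lambda>0:(P_{\lambda,f})\text{ has a classical solution}\}$. $\lambda_1(\Omega)$ is the first eigenvalue of $-\Delta$ in $H_0^1(\Omega)$, and $\phi_\Omega>0$ the corresponding eigenfunction normalized by $\int_\Omega\phi_\Omega\,dx=1$. If $\inf_\Omega f=0$ (or $C_F=\infty$) the corresponding quantity in the minimum is read as $+\infty$. *)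

(* Defs.v *)
From HB Require Import structures.
From mathcomp Require Import all_boot all_order all_algebra.
From mathcomp Require Import all_classical all_reals all_analysis.

Set Implicit Arguments.
Unset Strict Implicit.
Unset Printing Implicit Defensive.

Import Order.TTheory GRing.Theory Num.Theory.
Import numFieldNormedType.Exports.

Local Open Scope classical_set_scope.
Local Open Scope ring_scope.

(* R^n, as 'rV[R]_n, carries the sigma-algebra generated by the coordinates,
   that is, the Borel sigma-algebra. *)
Definition rV_display : measure_display.
Proof. exact. Qed.

Section rV_measurable.
Context {R : realType} {n : nat}.

Definition rV_coord (i : 'I_n) (x : 'rV[R]_n) : R := x ord0 i.

Let rV0 : g_sigma_preimage rV_coord set0.
Proof. exact: sigma_algebra0. Qed.

Let rVC A : g_sigma_preimage rV_coord A -> g_sigma_preimage rV_coord (~` A).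
Proof. exact: sigma_algebraC. Qed.

Let rV_bigcup (F : (set 'rV[R]_n)^nat) :
  (forall i, g_sigma_preimage rV_coord (F i)) ->
  g_sigma_preimage rV_coord (\bigcup_i F i).
Proof. exact: sigma_algebra_bigcup. Qed.

HB.instance Definition _ := @isMeasurable.Build rV_display
  'rV[R]_n (g_sigma_preimage rV_coord) rV0 rVC rV_bigcup.

End rV_measurable.

Section lebesgue_rV.
Variable R : realType.

Definition cons_rV n (p : measurableTypeR R * 'rV[R]_n) : 'rV[R]_n.+1 :=
  \row_i oapp (p.2 ord0) p.1 (unlift ord0 i).

Fixpoint lebesgue_rV n : set 'rV[R]_n -> \bar R :=
  match n with
  | 0 => dirac (0 : 'rV[R]_0)
  | m.+1 => pushforward (lebesgue_measure \x^ @lebesgue_rV m)%E (@cons_rV m)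
  end.

Lemma measurable_rV_coord n (i : 'I_n) :
  measurable_fun [set: 'rV[R]_n] (rV_coord i).
Proof.
move=> _ Y mY; rewrite setTI; apply: sub_sigma_algebra => /=.
rewrite -bigcup_seq/=; exists i => /=; first by rewrite mem_index_enum.
by exists Y => //; rewrite setTI.
Qed.

Lemma measurable_fun_rV d (T : measurableType d) n (f : T -> 'rV[R]_n) :
  (forall i, measurable_fun setT (rV_coord i \o f)) -> measurable_fun setT f.
Proof.
move=> mf _ A mA; rewrite setTI.
have H : g_sigma_preimage (fun i => rV_coord i \o f) `<=` measurable.
  apply: smallest_sub; first exact: sigma_algebra_measurable.
  rewrite -bigcup_seq => B [i _ [C mC <-]].
  exact: mf.
apply: H; rewrite g_sigma_preimage_comp.
by exists A => //; rewrite setTI.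
Qed.

Lemma measurable_cons_rV n : measurable_fun setT (@cons_rV n).
Proof.
apply: measurable_fun_rV => i.
case: (unliftP ord0 i) => [j|] ->.
- rewrite (_ : _ \o _ = rV_coord j \o snd); last first.
    by apply/funext => p; rewrite /= /rV_coord mxE liftK.
  exact: measurableT_comp (measurable_rV_coord j) measurable_snd.
- rewrite (_ : _ \o _ = fst); last first.
    by apply/funext => p; rewrite /= /rV_coord mxE unlift_none.
  exact: measurable_fst.
Qed.

Lemma lebesgue_rV_measure n :
  exists mu : {measure set 'rV[R]_n -> \bar R}, @lebesgue_rV n = mu.
Proof.
elim: n => [|n [mu muE]]; first by exists (dirac (0 : 'rV[R]_0)).
exists (measure_function_pushforward__canonical__measure_function_Measure
  (lebesgue_measure \x^ mu)%E (@measurable_cons_rV n)).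
by rewrite /= muE.
Qed.

Let leb0 n : @lebesgue_rV n set0 = 0%E.
Proof. by have [mu ->] := lebesgue_rV_measure n; exact: measure0. Qed.

Let leb_ge0 n A : (0 <= @lebesgue_rV n A)%E.
Proof. by have [mu ->] := lebesgue_rV_measure n; exact: measure_ge0. Qed.

Let leb_sigma_additive n : semi_sigma_additive (@lebesgue_rV n).
Proof.
by have [mu ->] := lebesgue_rV_measure n; exact: measure_semi_sigma_additive.
Qed.

HB.instance Definition _ n := isMeasure.Build _ _ _
  (@lebesgue_rV n) (@leb0 n) (@leb_ge0 n) (@leb_sigma_additive n).

End lebesgue_rV.
Arguments lebesgue_rV {R} n.

Section smoothness.
Context {R : realType} {n : nat}.
Implicit Types (f u : 'rV[R]_n -> R) (U : set 'rV[R]_n).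

Definition partial (i : 'I_n) f : 'rV[R]_n -> R :=
  fun x => 'D_(delta_mx ord0 i) f x.

Definition partials (s : seq 'I_n) f : 'rV[R]_n -> R := foldr partial f s.

Definition Ck_on (k : nat) U f := forall (s : seq 'I_n) x, (size s <= k)%N -> U x ->
  {for x, continuous (partials s f)} /\
  ((size s < k)%N -> forall i, derivable (partials s f) x (delta_mx ord0 i)).

Definition smooth_on U f := forall k, Ck_on k U f.

Definition laplacian u x : R := \sum_(i < n) partials [:: i; i] u x.

Definition boundary U := closure U `\` interior U.

(* Near each of its boundary points, U is the sublevel set {rho < 0} of a
   smooth function rho with nonvanishing gradient. *)
Definition smooth_boundary U := forall x0, boundary U x0 ->
  exists (V : set 'rV[R]_n) (rho : 'rV[R]_n -> R),
    [/\ open_nbhs x0 V, smooth_on V rho, exists i, partial i rho x0 != 0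
      & U `&` V = [set x | rho x < 0] `&` V].

Definition smooth_bounded_domain U :=
  [/\ open U, U !=set0, connected U, bounded_set U & smooth_boundary U].

(* |.| is the sup norm of R^n; an equivalent norm only changes the constant C *)
Definition holder_continuous U f := exists alpha C : R,
  [/\ 0 < alpha, alpha <= 1
    & forall x y, U x -> U y -> `|f x - f y| <= C * `|x - y| `^ alpha].

End smoothness.

Section dirichlet_spectrum.
Context {R : realType} {n : nat}.
Variable Omega : set 'rV[R]_n.
Local Notation mu := (lebesgue_rV n).

Definition test_function (phi : 'rV[R]_n -> R) :=
  [/\ smooth_on setT phi, compact (closure [set x | phi x != 0])
    & closure [set x | phi x != 0] `<=` Omega].

(* u belongs to H^1_0(Omega), the H^1-closure of the test functions, and G is
   its weak gradient. *)
Definition H10_grad (u : 'rV[R]_n -> R) (G : 'I_n -> 'rV[R]_n -> R) :=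
  [/\ measurable_fun Omega u, forall i, measurable_fun Omega (G i)
    & exists phi : nat -> 'rV[R]_n -> R,
      [/\ forall k, test_function (phi k),
          (\int[mu]_(x in Omega) ((phi k x - u x) ^+ 2)%:E)%E
            @[k --> \oo] --> 0%E
        & forall i, (\int[mu]_(x in Omega)
            ((partial i (phi k) x - G i x) ^+ 2)%:E)%E @[k --> \oo] --> 0%E]].

(* u lies in H^1_0(Omega) and solves - Delta u = l u weakly; u may be 0 *)
Definition dirichlet_eigenpair (l : R) (u : 'rV[R]_n -> R) :=
  exists2 G, H10_grad u G & forall v H, H10_grad v H ->
    (\int[mu]_(x in Omega) (\sum_(i < n) G i x * H i x) =
     l * \int[mu]_(x in Omega) (u x * v x))%R.

Definition dirichlet_eigenvalue (l : R) := exists u,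
  dirichlet_eigenpair l u /\ ~ {ae mu, forall x, Omega x -> u x = 0}.

Definition lambda1 : R := inf dirichlet_eigenvalue.

Definition normalized_first_eigenfunction (phi : 'rV[R]_n -> R) :=
  [/\ dirichlet_eigenpair lambda1 phi,
      {ae mu, forall x, Omega x -> 0 < phi x}
    & (\int[mu]_(x in Omega) (phi x)%:E = 1)%E].

End dirichlet_spectrum.

Section nonlinearity.
Context {R : realType}.
Implicit Types (a : \bar R) (F : R -> R).

Definition nl_domain a : set R := [set t | 0 <= t /\ (t%:E < a)%E].

Definition nl_interior a : set R := [set t | 0 < t /\ (t%:E < a)%E].

(* G k is the k-th derivative of F along D, one-sided at an endpoint of D *)
Definition smooth_within (D : set R) F := exists G : nat -> R -> R,
  {in D, G 0%N =1 F} /\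
  forall k x, D x ->
    (G k y - G k x) / (y - x) @[y --> within D x^'] --> G k.+1 x.

Definition nonlinearity a F :=
  [/\ smooth_within (nl_domain a) F,
      {in nl_domain a &, {homo F : x y / x <= y}},
      convex_function (nl_domain a : set R^o) F
    & F 0 = 1].

Definition regular a F :=
  [/\ nonlinearity a F, a = +oo%E & F t / t @[t --> +oo] --> +oo].

Definition singular a F :=
  [/\ nonlinearity a F, a = 1%E & F t @[t --> 1^'-] --> +oo].

Definition B_F a F : \bar R :=
  ereal_sup [set (t / F t)%:E | t in nl_interior a].

Definition C_F a F : \bar R :=
  (\int[lebesgue_measure]_(t in nl_interior a) ((F t)^-1)%:E)%E.

End nonlinearity.

Section semilinear_problem.
Context {R : realType} {n : nat}.
Variables (Omega : set 'rV[R]_n) (f : 'rV[R]_n -> R) (a : \bar R) (F : R -> R).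

(* Pointwise solutions in C^2(Omega), continuous up to the boundary: by elliptic
   regularity, and since f is Hoelder continuous, every weak solution staying
   away from a is of this kind. *)
Definition is_solution (lam : R) (u : 'rV[R]_n -> R) :=
  [/\ Ck_on 2 Omega u,
      {within closure Omega, continuous u},
      forall x, Omega x -> nl_domain a (u x),
      forall x, Omega x -> - laplacian u x = lam * f x * F (u x)
    & forall x, boundary Omega x -> u x = 0].

Definition classical_solution (lam : R) (u : 'rV[R]_n -> R) :=
  is_solution lam u /\ (ereal_sup [set `|u x|%:E | x in Omega] < a)%E.

Definition lambda_star : \bar R := ereal_sup
  [set lam%:E | lam in [set lam | 0 < lam /\ exists u, classical_solution lam u]].

End semilinear_problem.

(* Main.v *)
Require Import Defs.
From HB Require Import structures.
From mathcomp Require Import all_boot all_order all_algebra.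
From mathcomp Require Import all_classical all_reals all_analysis.
From mathcomp Require Import measurable_realfun ring lra.

(** Let u be a classical solution for lam. Multiplying the equation by the first
    eigenfunction phi and integrating by parts twice gives
      lam int f F(u) phi = lambda_1 int u phi,
    and u <= B_F F(u) yields the first bound, since int F(u) phi > 0. For the
    second bound let g be the primitive of 1 / F with g(0) = 0 and v = g(u), so
    that 0 <= v <= C_F. As F is nondecreasing,
      - Delta v = lam f + (F'(u) / F(u)^2) |grad u|^2 >= lam f,
    and the same integration by parts gives
      lam int f phi <= lambda_1 int v phi <= lambda_1 C_F.

    Both bounds thus follow from [superharmonic_test]: if 0 <= v <= C is of class
    C^2 and - Delta v >= h >= 0 in Omega, then int h phi <= lambda_1 int v phi.
    The difficulty is that phi is merely a weak solution in H^1_0 and that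
    nothing is known about the gradient of v near the boundary. The integration
    by parts is therefore done with test functions psi that approximate phi,
    composed with a smooth approximation of the sign: v ssgn(psi) is of class C^1
    with compact support and enters the equation of phi, whereas sabs(psi) - d
    is nonnegative whatever the sign of psi and is integrated against - Delta v.
    The cross terms cancel, the only remaining term of order one has a sign, and
    the error terms are controlled by a Caccioppoli estimate for v.

    Two facts about R^n carry the analysis. The integral of a derivative of a
    compactly supported function is zero, because the measure is translation
    invariant and difference quotients converge uniformly
    ([integral_is_derive_supported]). Functions of class C^1 with compact support
    belong to H^1_0 ([C1c_H10_grad]), by mollification with a kernel made from
    one of the test functions that approximate phi. *)

Set Implicit Arguments.
Unset Strict Implicit.
Unset Printing Implicit Defensive.

Import Order.TTheory GRing.Theory Num.Theory.
Import numFieldNormedType.Exports.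

Local Open Scope classical_set_scope.
Local Open Scope ring_scope.

(** * Borel sets and translations of R^n *)

Section borel_rV.
Context {R : realType} {n : nat}.
Local Notation mu := (@lebesgue_rV R n).

Lemma measurable_box (A : 'I_n -> set R) : (forall i, measurable (A i)) ->
  measurable [set x : 'rV[R]_n | forall i, A i (x ord0 i)].
Proof.
have fI : finite_set [set: 'I_n] by exact: finite_finset.
move=> mA.
rewrite (_ : [set x | _] = \bigcap_(i in [set: 'I_n]) (rV_coord i @^-1` A i)).
  apply: (fin_bigcap_measurable fI) => i _.
  by rewrite -[X in measurable X]setTI; exact: measurable_rV_coord.
by apply/seteqP; split => x /= Ax i; [move=> _|]; exact: Ax.
Qed.

Lemma ball_rVE (x : 'rV[R]_n) (e : R) : 0 < e ->
  ball x e = [set y | forall i, ball (x ord0 i) e (y ord0 i)].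
Proof.
move=> e0; apply/seteqP; split=> y /=.
  by move=> [_ xy] i; exact: xy.
by move=> xy; split=> // i j; rewrite (ord1 i); exact: xy.
Qed.

Lemma measurable_ball_rV (x : 'rV[R]_n) (e : R) : 0 < e ->
  measurable (ball x e : set 'rV[R]_n).
Proof.
move=> e0; rewrite ball_rVE//.
apply: (@measurable_box (fun i => ball (x ord0 i) e)) => i.
exact: measurable_ball.
Qed.

(** The balls of rational centre and radius 1 / (k + 1) form a countable base,
    and for the sup norm each of them is a box. *)
Lemma open_measurable_rV (U : set 'rV[R]_n) : open U -> measurable U.
Proof.
move=> oU.
pose q (p : 'rV[rat]_n) : 'rV[R]_n := map_mx ratr p.
pose B (p : 'rV[rat]_n * nat) : set 'rV[R]_n := ball (q p.1) p.2.+1%:R^-1.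
rewrite (_ : U = \bigcup_p [set y | B p `<=` U /\ B p y]).
  apply: countable_bigcupT_measurable => [|p]; first exact: countableP.
  have [pU|pU] := pselect (B p `<=` U); last first.
    by rewrite (_ : [set y | _] = set0)//; apply/seteqP; split => y //= [].
  rewrite (_ : [set y | _] = B p).
    by apply: measurable_ball_rV; rewrite invr_gt0.
  by apply/seteqP; split => y //= [].
apply/seteqP; split => [x Ux|x [p _ /= [pU]]]; last exact: pU.
have [e e0 xeU] : exists2 e : R, 0 < e & ball x e `<=` U.
  by move: (open_nbhs_nbhs (conj oU Ux)) => /nbhs_ballP[e]; exists e.
have [k ke] : exists k, (k.+1%:R^-1 : R) < e / 2.
  have := near_infty_natSinv_lt (PosNum (divr_gt0 e0 (@ltr0Sn R 1))).
  by case=> k _ /(_ k (leqnn k)) /= ke; exists k.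
have k0 : (0 : R) < k.+1%:R^-1 by rewrite invr_gt0.
have [p px] : exists p : 'rV[rat]_n, ball x k.+1%:R^-1 (q p).
  have H i : {r : rat | ball (x ord0 i) k.+1%:R^-1 (ratr r : R)}.
    apply: cid.
    have [r] := @rat_in_itvoo R (x ord0 i - k.+1%:R^-1) (x ord0 i + k.+1%:R^-1)
      ltac:(by rewrite ltrD2l gtrN).
    rewrite in_itv/= => /andP[r1 r2]; exists r.
    rewrite /ball/= ltr_norml; apply/andP; split; last first.
      by rewrite ltrBlDl addrC -ltrBlDl.
    by rewrite ltrNl opprB ltrBlDl.
  exists (\row_i sval (H i)); rewrite ball_rVE// => i /=.
  by rewrite !mxE; exact: (svalP (H i)).
exists (p, k) => //=; split=> /=; last exact/ball_sym.
move=> y py; apply: xeU.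
rewrite (_ : e = e / 2 + e / 2); last by rewrite -splitr.
apply: (@ball_triangle _ _ (q p)); [move: px|move: py];
  by apply: le_ball; exact: ltW.
Qed.

End borel_rV.

Lemma lebesgue_measure_translation (R : realType) (c : R) (A : set R) :
  measurable A ->
  pushforward lebesgue_measure
    (fun x : measurableTypeR R => x + c : measurableTypeR R) A =
  lebesgue_measure A.
Proof.
move=> mA.
have mf : measurable_fun [set: measurableTypeR R]
    (fun x : measurableTypeR R => x + c : measurableTypeR R).
  exact: measurable_funD.
pose m := measure_function_pushforward__canonical__measure_function_Measure
  lebesgue_measure mf.
apply/esym; apply: (@lebesgue_measure_unique R m) => // X [[a b]] /= _ <-.
rewrite /m /= /pushforward.
rewrite (_ : _ @^-1` _ = `]a - c, b - c]%classic); last first.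
  apply/seteqP; split=> x /=; rewrite !in_itv/=; lra.
rewrite !lebesgue_measure_itv/= !lte_fin ltrD2r -!EFinB.
by rewrite (_ : b - c - (a - c) = b - a)//; ring.
Qed.

Section lebesgue_rV_theory.
Context {R : realType}.
Local Notation mu n := (@lebesgue_rV R n).

Let boxE n (A : 'I_n.+1 -> set R) :
  (@cons_rV R n) @^-1` [set x | forall i, A i (x ord0 i)] =
  A ord0 `*` [set x : 'rV[R]_n | forall i, A (lift ord0 i) (x ord0 i)].
Proof.
apply/seteqP; split => -[t x] /=.
  move=> H; split=> [|i]; first by have := H ord0; rewrite mxE unlift_none.
  by have := H (lift ord0 i); rewrite mxE liftK.
by move=> [H0 H] i; rewrite mxE; case: (unliftP ord0 i) => [j|] ->.
Qed.

Lemma lebesgue_rV_boxS n (A : 'I_n.+1 -> set R) : (forall i, measurable (A i)) ->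
  (mu n.+1 [set x | forall i, A i (x ord0 i)] =
   lebesgue_measure (A ord0) *
   mu n [set x : 'rV[R]_n | forall i, A (lift ord0 i) (x ord0 i)])%E.
Proof.
move=> mA; rewrite /= /pushforward boxE.
rewrite product_measure2E//; first exact: mA.
by apply: (@measurable_box R n (fun i => A (lift ord0 i))) => i; exact: mA.
Qed.

Lemma lebesgue_rV_box_lty n (A : 'I_n -> set R) : (forall i, measurable (A i)) ->
  (forall i, lebesgue_measure (A i) < +oo)%E ->
  (mu n [set x | forall i, A i (x ord0 i)] < +oo)%E.
Proof.
elim: n A => [|n IH] A mA Afin.
  by rewrite /= diracE; case: (_ \in _); rewrite ltey.
rewrite lebesgue_rV_boxS// lte_mul_pinfty//.
- by rewrite ge0_fin_numE.
- exact: (IH (fun i => A (lift ord0 i))).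
Qed.

Lemma lebesgue_rV_box_gt0 n (A : 'I_n -> set R) : (forall i, measurable (A i)) ->
  (forall i, 0 < lebesgue_measure (A i))%E ->
  (0 < mu n [set x | forall i, A i (x ord0 i)])%E.
Proof.
elim: n A => [|n IH] A mA A0.
  by rewrite /= diracE mem_set//=; case.
rewrite lebesgue_rV_boxS// mule_gt0//.
exact: (IH (fun i => A (lift ord0 i))).
Qed.

Lemma lebesgue_rV_ball_gt0 n (x : 'rV[R]_n) (e : R) : 0 < e ->
  (0 < mu n (ball x e))%E.
Proof.
move=> e0; rewrite ball_rVE//.
apply: (@lebesgue_rV_box_gt0 _ (fun i => ball (x ord0 i) e)) => i.
  exact: measurable_ball.
by rewrite lebesgue_measure_ball ?ltW// lte_fin mulr2n addr_gt0.
Qed.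

Lemma lebesgue_rV_ball_lty n (x : 'rV[R]_n) (e : R) : 0 < e ->
  (mu n (ball x e) < +oo)%E.
Proof.
move=> e0; rewrite ball_rVE//.
apply: (@lebesgue_rV_box_lty _ (fun i => ball (x ord0 i) e)) => i.
  exact: measurable_ball.
by rewrite lebesgue_measure_ball ?ltW// ltey.
Qed.

Lemma measurable_translation n (c : 'rV[R]_n) :
  measurable_fun [set: 'rV[R]_n] (fun x => x + c).
Proof.
apply: measurable_fun_rV => i.
rewrite (_ : _ \o _ = fun x => rV_coord i x + c ord0 i); last first.
  by apply/funext => x; rewrite /= /rV_coord mxE.
by apply: measurable_funD => //; exact: measurable_rV_coord.
Qed.

(** Induction on the dimension. Integrating over the last n coordinates y, a
    translation first moves the slice of A above y inside R, which Lebesgue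
    measure on R ignores, and then moves y itself, which the induction
    hypothesis ignores. *)
Lemma lebesgue_rV_translation n (c : 'rV[R]_n) (A : set 'rV[R]_n) :
  measurable A -> mu n ((fun x => x + c) @^-1` A) = mu n A.
Proof.
elim: n c A => [|n IH] c A mA.
  rewrite /= !diracE; congr (nat_of_bool _)%:R%:E.
  by apply/idP/idP => /set_mem H; apply/mem_set; move: H => /=;
    rewrite thinmx0 ?addr0// [0 + c]thinmx0.
pose c' : 'rV[R]_n := \row_i c ord0 (lift ord0 i).
have mcA : measurable (@cons_rV R n @^-1` A).
  by rewrite -[X in measurable X]setTI; exact: measurable_cons_rV.
pose h (y : 'rV[R]_n) : \bar R :=
  lebesgue_measure (ysection (@cons_rV R n @^-1` A) y).
have mh : measurable_fun setT h by exact: measurable_fun_ysection.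
transitivity (\int[mu n]_y h (y + c')%R)%E.
  rewrite /= /pushforward /product_measure2; apply: eq_integral => y _ /=.
  have mS : measurable (ysection (@cons_rV R n @^-1` A) (y + c')).
    exact: measurable_ysection.
  rewrite /h -(lebesgue_measure_translation (c ord0 ord0) mS).
  rewrite /pushforward; congr (lebesgue_measure _).
  apply/seteqP; split => t /=; rewrite /ysection /= !inE /=;
    set u := (X in A X); set w := (X in _ -> A X); suff -> : u = w by [];
    by apply/rowP => i; rewrite !mxE /=; case: (unliftP ord0 i) => [j|] ->/=;
      rewrite ?mxE.
transitivity (\int[pushforward (mu n) (fun y => (y + c')%R)]_y h y)%E.
  by rewrite (ge0_integral_pushforward (measurable_translation c')).
have mt := measurable_translation c'.
pose m := measure_function_pushforward__canonical__measure_function_Measure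
  (mu n) mt.
transitivity (\int[mu n]_y h y)%E; last by [].
apply: (@eq_measure_integral _ _ _ _ (mu n) m) => B mB _.
exact: IH.
Qed.

Lemma integral_pushforward_translation n (c : 'rV[R]_n) (f : 'rV[R]_n -> \bar R) :
  (\int[pushforward (mu n) (fun y => (y + c)%R)]_y f y = \int[mu n]_y f y)%E.
Proof.
have mt := measurable_translation c.
pose m := measure_function_pushforward__canonical__measure_function_Measure
  (mu n) mt.
apply: (@eq_measure_integral _ _ _ _ (mu n) m) => B mB _.
exact: lebesgue_rV_translation.
Qed.

Lemma integrable_translation n (c : 'rV[R]_n) (f : 'rV[R]_n -> R) :
  (mu n).-integrable setT (EFin \o f) ->
  (mu n).-integrable setT (EFin \o (fun x => f (x + c))).
Proof.
move=> fi.
have mf : measurable_fun setT f by apply/measurable_EFinP; exact: measurable_int fi.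
apply/integrableP; split.
  apply/measurable_EFinP.
  exact: (measurableT_comp mf (measurable_translation c)).
have /integrableP[_] := fi; apply: le_lt_trans.
rewrite (_ : (\int[_]_x `|_|)%E =
  \int[pushforward (mu n) (fun y => (y + c)%R)]_y `|(EFin \o f) y|)%E; last first.
  rewrite (ge0_integral_pushforward (measurable_translation c))//.
  apply: measurableT_comp => //; exact/measurable_EFinP.
by rewrite integral_pushforward_translation.
Qed.

Lemma Rintegral_translation n (c : 'rV[R]_n) (f : 'rV[R]_n -> R) :
  (mu n).-integrable setT (EFin \o f) ->
  \int[mu n]_x f (x + c) = \int[mu n]_x f x.
Proof.
move=> fi; rewrite /Rintegral; congr fine.
have mf : measurable_fun setT f by apply/measurable_EFinP; exact: measurable_int fi.
transitivity (\int[pushforward (mu n) (fun y => (y + c)%R)]_y (f y)%:E)%E.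
  rewrite (@integral_pushforward _ _ _ _ _ _ (measurable_translation c) (mu n)
    setT (EFin \o f))//.
    exact/measurable_EFinP.
  exact: integrable_translation.
exact: integral_pushforward_translation.
Qed.

End lebesgue_rV_theory.

(** * Continuous functions with compact support *)

Section continuous_rV.
Context {R : realType} {n : nat}.
Local Notation rV := 'rV[R]_n.
Local Notation mu := (@lebesgue_rV R n).

Lemma open_continuous_measurable_rV (D : set rV) (f : rV -> R) : open D ->
  (forall x, D x -> {for x, continuous f}) -> measurable_fun D f.
Proof.
move=> oD cf; apply: (measurability _ (RGenOpens.measurableE R)).
move=> _ [_ [a [b ->] <-]]; apply: open_measurable_rV.
rewrite openE => x [Dx fx]; apply: filterI.
  exact: open_nbhs_nbhs.
by apply: (cf x Dx); apply: open_nbhs_nbhs; split => //; exact: interval_open.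
Qed.

Lemma bounded_set_rV_lty (A : set rV) : bounded_set A -> measurable A ->
  (mu A < +oo)%E.
Proof.
move=> [M [_ HM]] mA.
pose r := `|M| + 1.
have r0 : 0 < r + 1 by rewrite addr_gt0// ltr_wpDl.
apply: le_lt_trans (lebesgue_rV_ball_lty (0 : rV) r0).
apply: le_measure; rewrite ?inE//; first exact: measurable_ball_rV.
move=> x Ax; rewrite -ball_normE /ball_ /= sub0r normrN.
rewrite (@le_lt_trans _ _ r)//; last by rewrite ltrDl.
by apply: HM => //; rewrite ltr_pwDr// ler_norm.
Qed.

Lemma compact_rV_closed (K : set rV) : compact K -> closed K.
Proof. by apply: compact_closed; exact: norm_hausdorff. Qed.

Lemma compact_rV_measurable (K : set rV) : compact K -> measurable K.
Proof.
move=> /compact_rV_closed cK; rewrite -(setCK K); apply: measurableC.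
by apply: open_measurable_rV; exact: closed_openC.
Qed.

Lemma compact_rV_lty (K : set rV) : compact K -> (mu K < +oo)%E.
Proof.
move=> cK; apply: bounded_set_rV_lty; first exact: compact_bounded.
exact: compact_rV_measurable.
Qed.

Section compactly_supported.
Variables (K : set rV) (f : rV -> R).
Hypotheses (cK : compact K) (cf : continuous f)
  (f0 : forall x, ~ K x -> f x = 0).

Lemma supported_bounded : exists2 M, 0 < M & forall x, `|f x| <= M.
Proof.
have : compact (f @` K).
  by apply: continuous_compact => //; apply: continuous_subspaceT => x; exact: cf.
move=> /compact_bounded[M [_ HM]].
exists (`|M| + 1) => [|x]; first by rewrite ltr_wpDl.
have [Kx|Kx] := pselect (K x); last by rewrite f0// normr0 addr_ge0.
by apply: HM; [rewrite ltr_pwDr// ler_norm|exists x].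
Qed.

(** Heine-Cantor on K; two points that both lie outside K cost nothing, so the
    modulus is valid on the whole space. *)
Lemma supported_unif_continuous (e : R) : 0 < e ->
  exists2 d, 0 < d & forall x y, `|x - y| < d -> `|f x - f y| < e.
Proof.
move=> e0.
have e20 : 0 < e / 2 by rewrite divr_gt0.
have H : \forall d \near (0:R)^'+,
    K `<=` [set x | forall y, `|x - y| < d -> `|f x - f y| < e].
  apply: (proj1 (compact_near_coveringP K) cK R (0:R)^'+
    (fun d x => forall y, `|x - y| < d -> `|f x - f y| < e)) => x Kx.
  have cfx : f y @[y --> x] --> f x by exact: cf.
  move/cvgrPdist_lt : cfx => /(_ _ e20).
  rewrite -nbhs_ballE => -[r /= r0 rf].
  have r20 : 0 < r / 2 by rewrite divr_gt0.
  exists (ball x (r / 2), [set d | d < r / 2]) => /=.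
    split; first exact: nbhsx_ballx.
    near=> d => /=; near: d; exact: nbhs_right_lt.
  move=> [x' d] /= [xx' dr] y x'y.
  have H1 : `|f x - f x'| < e / 2.
    by apply: rf; apply: le_ball xx'; rewrite ler_pdivrMr// ler_pMr// ler1n.
  have H2 : `|f x - f y| < e / 2.
    apply: rf; rewrite -ball_normE /ball_ /= (splitr r).
    rewrite -(subrK x' x) -addrA (le_lt_trans (ler_normD _ _))// ltrD//.
      by move: xx'; rewrite -ball_normE.
    exact: lt_trans dr.
  rewrite (splitr e) -(subrK (f x) (f x')) -addrA.
  by rewrite (le_lt_trans (ler_normD _ _))// ltrD// distrC.
have [d [d0 dK]] : exists d : R, 0 < d /\
    K `<=` [set x | forall y, `|x - y| < d -> `|f x - f y| < e].
  near (0:R)^'+ => d; exists d; split; first by [].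
  by near: d.
exists d => // x y xy.
have [Kx|Kx] := pselect (K x); first exact: dK.
have [Ky|Ky] := pselect (K y); first by rewrite distrC; apply: dK => //; rewrite distrC.
by rewrite !f0// subrr normr0.
Unshelve. all: end_near. Qed.

Lemma supported_measurable (D : set rV) : measurable_fun D f.
Proof.
apply: measurable_funTS; apply: open_continuous_measurable_rV; first exact: openT.
by move=> x _; exact: cf.
Qed.

Lemma supported_integrable : mu.-integrable setT (EFin \o f).
Proof.
have mK := compact_rV_measurable cK.
have : mu.-integrable K (EFin \o f).
  apply: measurable_bounded_integrable => //.
  - exact: compact_rV_lty.
  - exact: supported_measurable.
  - have [M M0 fM] := supported_bounded.
    exists M; split; rewrite ?num_real// => y My x _ /=.
    exact: le_trans (ltW My).
rewrite -(setTI K) => /(integrable_restrict _ mK measurableT).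
congr (_.-integrable); apply/funext => x; rewrite patchE.
by case: ifPn => //= /negP xK; rewrite f0// => /mem_set.
Qed.

End compactly_supported.
End continuous_rV.

(** * Real-valued integrable functions *)

Section real_integrable.
Context d (T : measurableType d) (R : realType).
Variables (mu : {measure set T -> \bar R}) (D : set T).
Hypothesis mD : measurable D.
Implicit Types f g : T -> R.
Local Notation intg f := (mu.-integrable D (EFin \o f)).

Lemma rintegrableD f g : intg f -> intg g -> intg (fun x => f x + g x).
Proof. by move=> fi gi; exact: (integrableD mD fi gi). Qed.

Lemma rintegrableB f g : intg f -> intg g -> intg (fun x => f x - g x).
Proof. by move=> fi gi; exact: (integrableB mD fi gi). Qed.

Lemma rintegrableZ k f : intg f -> intg (fun x => k * f x).
Proof. by move=> fi; exact: (integrableZl mD k fi). Qed.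

Lemma rintegrable_norm f : intg f -> intg (fun x => `|f x|).
Proof. by move=> fi; exact: (integrable_abse fi). Qed.

Lemma rintegrable_sum I (s : seq I) (h : I -> T -> R) :
  (forall i, intg (h i)) -> intg (fun x => \sum_(i <- s) h i x).
Proof.
move=> hi; have := integrable_sum mD s (fun i (_ : xpredT i) => hi i).
congr (_.-integrable); apply/funext => x /=.
by rewrite sumEFin.
Qed.

Lemma eq_rintegrable f g : (forall x, D x -> f x = g x) -> intg f -> intg g.
Proof.
move=> fg; apply: eq_integrable => // x /set_mem Dx /=.
by rewrite fg.
Qed.

Lemma rintegrable_bounded f M : (mu D < +oo)%E -> measurable_fun D f ->
  (forall x, D x -> `|f x| <= M) -> intg f.
Proof.
move=> Dfin mf fM; apply: measurable_bounded_integrable => //.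
exists M; split; rewrite ?num_real// => y My x Dx /=.
exact: le_trans (fM x Dx) (ltW My).
Qed.

Lemma le_rintegrable f g : measurable_fun D f ->
  (forall x, D x -> `|f x| <= g x) -> intg g -> intg f.
Proof.
move=> mf fg; apply: le_integrable => //; first exact/measurable_EFinP.
by move=> x Dx /=; rewrite lee_fin (le_trans (fg x Dx))// ler_norm.
Qed.

End real_integrable.

(** * Directional derivatives and their integrals *)

Section directional_derivative.
Context {R : realType} {V : normedModType R}.
Implicit Types (f g : V -> R) (x e : V).

(** Directional derivatives become derivatives of one real variable, for which
    the chain rule and the mean value theorem are available. *)
Lemma is_derive_slice f x e (d t : R) :
  is_derive (t *: e + x) e f d <-> is_derive t 1 (fun s => f (s *: e + x)) d.
Proof.
have E : (fun h => h^-1 *: ((f \o shift (t *: e + x)) (h *: e) - f (t *: e + x))) =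
   (fun h : R => h^-1 *: (((fun s => f (s *: e + x)) \o shift t) (h *: 1) -
                          f (t *: e + x))).
  by apply/funext => h /=; rewrite [h *: 1]mulr1 scalerDl addrA.
by split=> -[D1 D2]; (split; [move: D1; rewrite /derivable E|move: D2; rewrite /derive E]).
Qed.

Lemma is_derive_comp1 f x e (d d' : R) (g : R -> R) :
  is_derive x e f d -> is_derive (f x) 1 g d' ->
  is_derive x e (fun y => g (f y)) (d' * d).
Proof.
move=> fd gd.
rewrite -[x]add0r -(scale0r e); apply/is_derive_slice.
have H : is_derive (0:R) 1 (fun s => f (s *: e + x)) d.
  by apply/is_derive_slice; rewrite scale0r add0r.
apply: (@is_derive1_comp _ g (fun s => f (s *: e + x))).
by rewrite scale0r add0r.
Qed.

Lemma MVT_directional f (df : V -> R) x e (t : R) :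
  (forall y, is_derive y e f (df y)) ->
  exists2 s, `|s| <= `|t| & f (t *: e + x) - f x = t * df (s *: e + x).
Proof.
move=> fd.
pose g s := f (s *: e + x).
have gd s : is_derive s (1 : R) g (df (s *: e + x)) by apply/is_derive_slice; exact: fd.
have cg : continuous g.
  by move=> s; apply: differentiable_continuous; apply/derivable1_diffP.
have -> : f x = g 0 by rewrite /g scale0r add0r.
rewrite -/(g t).
have [t0|t0] := leP 0 t.
  have [|s] := @MVT_segment _ g (fun s => df (s *: e + x)) 0 t t0 (fun s _ => gd s).
    by apply: continuous_subspaceT => s; exact: cg.
  rewrite in_itv/= subr0 => /andP[s0 st] ->; exists s; last by rewrite mulrC.
  by rewrite !ger0_norm.
have [|s] := @MVT_segment _ g (fun s => df (s *: e + x)) t 0 (ltW t0) (fun s _ => gd s).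
  by apply: continuous_subspaceT => s; exact: cg.
rewrite in_itv/= sub0r => /andP[st s0] E; exists s; last first.
  by move: E; rewrite mulrN mulrC => /(congr1 -%R); rewrite opprB opprK.
by rewrite !ler0_norm ?lerN2// ltW.
Qed.

(** By the mean value theorem a difference quotient of f is a value of df at a
    nearby point, so a uniform modulus for df makes the quotients converge
    uniformly. *)
Lemma unif_difference_quotient f (df : V -> R) e :
  (forall y, is_derive y e f (df y)) ->
  (forall eps : R, 0 < eps ->
    exists2 d, 0 < d & forall x y, `|x - y| < d -> `|df x - df y| < eps) ->
  forall eps : R, 0 < eps -> exists2 d : R, 0 < d & forall t x, t != 0 -> `|t| < d ->
    `|t^-1 * (f (t *: e + x) - f x) - df x| < eps.
Proof.
move=> fd ud eps /ud [d d0 dd].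
have e1 : 0 < `|e| + 1 by rewrite ltr_wpDl.
exists (d / (`|e| + 1)) => [|t x t0 td]; first exact: divr_gt0.
have [s st ->] := MVT_directional x t fd.
rewrite mulrA mulVf// mul1r; apply: dd.
rewrite addrK normrZ (@le_lt_trans _ _ (`|t| * (`|e| + 1)))//.
  by rewrite ler_pM// lerDl.
by rewrite -ltr_pdivlMr.
Qed.

End directional_derivative.

Section integral_derivative.
Context {R : realType} {n : nat}.
Local Notation rV := 'rV[R]_n.
Local Notation mu := (@lebesgue_rV R n).

Lemma is_derive_supported (K : set rV) (f df : rV -> R) (e : rV) : compact K ->
  (forall x, is_derive x e f (df x)) -> (forall x, ~ K x -> f x = 0) ->
  forall x, ~ K x -> df x = 0.
Proof.
move=> cK fd f0 x Kx.
have : is_derive x e f 0.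
  have D0 : is_derive x e (cst (0 : R)) (0 : R) by exact: (is_derive_cst 0 x e).
  apply: near_eq_is_derive D0.
  have oK : open (~` K) by apply: closed_openC; exact: compact_rV_closed.
  have := open_nbhs_nbhs (conj oK Kx).
  by apply: filterS => y /= /f0 ->.
by move=> [_ <-]; case: (fd x) => _ <-.
Qed.

(** The divergence theorem without boundary. A difference quotient of f has
    integral zero because the measure is translation invariant, and it tends
    to df uniformly; the error is carried by K and by a translate of K, hence
    by a set of bounded measure. *)
Lemma integral_is_derive_supported (K : set rV) (f df : rV -> R) (e : rV) : compact K ->
  continuous f -> continuous df ->
  (forall x, is_derive x e f (df x)) -> (forall x, ~ K x -> f x = 0) ->
  \int[mu]_x df x = 0.
Proof.
move=> cK cf cdf fd f0.
have df0 := is_derive_supported cK fd f0.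
have fi := supported_integrable cK cf f0.
have dfi := supported_integrable cK cdf df0.
have mK := compact_rV_measurable cK.
pose k x : R := \1_K x.
have ki : mu.-integrable setT (EFin \o k).
  have : mu.-integrable K (EFin \o cst 1).
    apply: measurable_bounded_integrable => //; first exact: compact_rV_lty.
    exact: bounded_cst.
  rewrite -(setTI K) => /(integrable_restrict _ mK measurableT).
  congr (_.-integrable); apply/funext => x.
  by rewrite patchE /= /k indicE; case: ifPn.
apply/eqP; rewrite -normr_le0; apply/ler_addgt0Pl => eps eps0; rewrite addr0.
pose c := \int[mu]_x k x.
have c0 : 0 <= c by apply: Rintegral_ge0 => x _; rewrite /k indicE.
pose eps' := eps / (c + c + 1).
have eps'0 : 0 < eps' by rewrite divr_gt0// ltr_wpDl// addr_ge0.
have [d d0 Hd] :=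
  unif_difference_quotient fd (supported_unif_continuous cK cdf df0) eps'0.
pose t := d / 2.
have t0 : t != 0 by rewrite gt_eqF// divr_gt0.
have td : `|t| < d by rewrite gtr0_norm ?divr_gt0// ltr_pdivrMr// ltr_pMr// ltr1n.
pose q x := t^-1 * (f (x + t *: e) - f x).
have fti : mu.-integrable setT (EFin \o (fun x => f (x + t *: e))).
  exact: integrable_translation.
have fdi : mu.-integrable setT (EFin \o (fun x => f (x + t *: e) - f x)).
  exact: rintegrableB.
have qi : mu.-integrable setT (EFin \o q) by exact: rintegrableZ.
have q0 : \int[mu]_x q x = 0.
  rewrite /q RintegralZl// RintegralB//.
  by rewrite Rintegral_translation// subrr mulr0.
have kti : mu.-integrable setT (EFin \o (fun x => k (x + t *: e))).
  exact: integrable_translation.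
have kki : mu.-integrable setT (EFin \o (fun x => k x + k (x + t *: e))).
  exact: rintegrableD.
have -> : \int[mu]_x df x = \int[mu]_x (df x - q x).
  by rewrite RintegralB// q0 subr0.
have dqi : mu.-integrable setT (EFin \o (fun x => df x - q x)) by exact: rintegrableB.
apply: (le_trans (le_normr_Rintegral _ _)) => //.
apply: (@le_trans _ _ (\int[mu]_x (eps' * (k x + k (x + t *: e))))).
  apply: le_Rintegral => //.
  - exact: rintegrable_norm.
  - exact: rintegrableZ.
  move=> x _.
  have H : `|df x - q x| <= eps'.
    by rewrite distrC /q [x + _]addrC; exact/ltW/Hd.
  rewrite /k !indicE.
  case: (boolP (x \in K)) => xK.
    by apply: (le_trans H); apply: ler_peMr; [exact: ltW|rewrite lerDl].
  case: (boolP (_ \in K)) => xtK; first by rewrite /= add0r mulr1.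
  rewrite /q df0; last by move=> /mem_set; exact/negP.
  rewrite !f0; do ?by move=> /mem_set; exact/negP.
  by rewrite subrr mulr0 subrr normr0 addr0 mulr0.
rewrite RintegralZl// RintegralD// Rintegral_translation// -/c /eps'.
rewrite mulrAC ler_pdivrMr; last by rewrite ltr_wpDl// addr_ge0.
by rewrite ler_pM2l// lerDl.
Qed.
End integral_derivative.

(** * Closure properties of smooth functions *)

Lemma is_derive_mull (R : realType) (a x : R) :
  is_derive x (1 : R) (fun s => a * s) a.
Proof.
have Da : is_derive x (1 : R) (cst a) 0 by exact: is_derive_cst.
have Di : is_derive x (1 : R) (id : R -> R) 1 by exact: is_derive_id.
have := is_deriveM Da Di.
by rewrite /GRing.scale/= mulr1 mulr0 addr0.
Qed.

Section smooth_closure.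
Context {R : realType} {n : nat}.
Local Notation rV := 'rV[R]_n.
Implicit Types (f g : rV -> R) (k : nat).
Local Notation e i := (delta_mx ord0 i : rV).
Local Notation Ck k f := (@Ck_on R n k setT f).

Lemma partials_rcons s i f : partials (rcons s i) f = partials s (partial i f).
Proof. by rewrite /partials foldr_rcons. Qed.

(** The head of the list is differentiated last, so a derivative is split off
    at the end of the list; this is the induction step for all closure
    properties of smoothness. *)
Lemma CkS k f : Ck k.+1 f <->
  continuous f /\ forall i, (forall x, derivable f x (e i)) /\ Ck k (partial i f).
Proof.
split=> [H|[cf H] s x].
  split=> [x|i]; first by have [] := H [::] x isT I.
  split=> [x|s x sk _]; first by have [_ /(_ isT)] := H [::] x isT I.
  have [] := H (rcons s i) x; rewrite ?size_rcons// partials_rcons => H1 H2.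
  by split.
case/lastP: s => [_ _|s i].
  by split=> [|_ i]; [exact: cf|exact: (H i).1].
rewrite size_rcons !partials_rcons !ltnS => sk _.
exact: (H i).2.
Qed.

Lemma Ck_le k f : Ck k.+1 f -> Ck k f.
Proof.
move=> H s x sk _; have [H1 H2] := H s x (leqW sk) I.
by split=> // _; apply: H2.
Qed.

Lemma is_derive_partial f x i : derivable f x (e i) -> is_derive x (e i) f (partial i f x).
Proof. exact: derivableP. Qed.

Lemma partialE f df i : (forall x, is_derive x (e i) f (df x)) -> partial i f = df.
Proof. by move=> fd; apply/funext => x; case: (fd x). Qed.

Lemma CkD k f g : Ck k f -> Ck k g -> Ck k (fun x => f x + g x).
Proof.
elim: k f g => [|k IH] f g.
  move=> Hf Hg [|//] x _ _; split => //.
  by apply: continuousD; [exact: (Hf [::] x isT I).1|exact: (Hg [::] x isT I).1].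
move=> /CkS[cf Hf] /CkS[cg Hg]; apply/CkS; split=> [x|i].
  by apply: continuousD; [exact: cf|exact: cg].
have D x : is_derive x (e i) (fun x => f x + g x) (partial i f x + partial i g x).
  have Df := is_derive_partial ((Hf i).1 x).
  have Dg := is_derive_partial ((Hg i).1 x).
  exact: (is_deriveD Df Dg).
split=> [x|]; first by case: (D x).
by rewrite (partialE D); apply: IH; [exact: (Hf i).2|exact: (Hg i).2].
Qed.

Lemma CkM k f g : Ck k f -> Ck k g -> Ck k (fun x => f x * g x).
Proof.
elim: k f g => [|k IH] f g.
  move=> Hf Hg [|//] x _ _; split => //.
  by apply: continuousM; [exact: (Hf [::] x isT I).1|exact: (Hg [::] x isT I).1].
move=> kf kg; have /CkS[cf Hf] := kf; have /CkS[cg Hg] := kg.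
apply/CkS; split=> [x|i].
  by apply: continuousM; [exact: cf|exact: cg].
have D x : is_derive x (e i) (fun x => f x * g x)
    (f x * partial i g x + g x * partial i f x).
  have Df := is_derive_partial ((Hf i).1 x).
  have Dg := is_derive_partial ((Hg i).1 x).
  exact: (is_deriveM Df Dg).
split=> [x|]; first by case: (D x).
rewrite (partialE D); apply: CkD; apply: IH.
- exact: Ck_le.
- exact: (Hg i).2.
- exact: Ck_le.
- exact: (Hf i).2.
Qed.

Lemma Ck_cst k (c : R) : Ck k (fun=> c).
Proof.
elim: k c => [|k IH] c.
  by move=> [|//] x _ _; split => //; exact: cst_continuous.
apply/CkS; split=> [x|i]; first exact: cst_continuous.
have D x : is_derive x (e i) (fun=> c) 0 by exact: (is_derive_cst c x (e i)).
split=> [x|]; first by case: (D x).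
by rewrite (partialE D).
Qed.

Lemma Ck_affine k f (a : R) (x0 : rV) : Ck k f -> Ck k (fun y => f (a *: y + x0)).
Proof.
have ca : continuous (fun y : rV => a *: y + x0).
  by move=> y; apply: continuousD; [exact: scaler_continuous|exact: cst_continuous].
elim: k f => [|k IH] f.
  move=> Hf [|//] x _ _; split => //.
  have [H _] := Hf [::] (a *: x + x0) isT I.
  by exact: continuous_comp (ca x) H.
move=> /CkS[cf Hf]; apply/CkS; split=> [x|i].
  by exact: continuous_comp (ca x) (cf _).
have D x : is_derive x (e i) (fun y => f (a *: y + x0)) (a * partial i f (a *: x + x0)).
  pose g s := f (s *: e i + (a *: x + x0)).
  have Dg : is_derive (a * 0) 1 g (partial i f (a *: x + x0)).
    apply/(is_derive_slice f (a *: x + x0) (e i)).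
    by rewrite mulr0 scale0r add0r; apply: is_derive_partial; exact: (Hf i).1.
  rewrite -[x in is_derive x _ _ _]add0r -(scale0r (e i)).
  apply/(is_derive_slice (fun y => f (a *: y + x0)) x (e i)).
  rewrite (_ : (fun s => _) = g \o (fun s : R => a * s)); last first.
    by apply/funext => s; rewrite /g /= scalerDr scalerA addrA.
  by rewrite mulrC; exact: (is_derive1_comp Dg (is_derive_mull a 0)).
split=> [x|]; first by case: (D x).
rewrite (partialE D); apply: CkM; first exact: Ck_cst.
apply: IH; exact: (Hf i).2.
Qed.

End smooth_closure.

(** * Cross-correlation with a kernel *)

Lemma is_derive_epsilon (R : realType) (V : normedModType R) (f : V -> R)
    (x e : V) (l : R) :
  (forall eps : R, 0 < eps -> exists2 d : R, 0 < d & forall t, t != 0 -> `|t| < d ->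
    `|t^-1 * (f (t *: e + x) - f x) - l| < eps) -> is_derive x e f l.
Proof.
move=> H.
have C : (fun h => h^-1 *: ((f \o shift x) (h *: e) - f x)) @ 0^' --> l.
  apply/cvgrPdist_lt => eps /H [d d0 Hd]; rewrite near_withinE.
  apply: (filterS _ (nbhsx_ballx (0 : R) d d0)) => t.
  rewrite -ball_normE /ball_ /= sub0r normrN => td t0.
  by rewrite distrC; exact: Hd.
split; first by apply/cvg_ex; exists l.
exact/cvg_lim.
Qed.

Lemma epsilon_continuous_at (R : realType) (V : normedModType R) (f : V -> R) (x : V) :
  (forall eps : R, 0 < eps -> exists2 d : R, 0 < d & forall y, `|x - y| < d ->
    `|f x - f y| < eps) -> {for x, continuous f}.
Proof.
move=> H; apply/cvgrPdist_lt => eps /H [d d0 Hd].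
apply: (filterS _ (nbhsx_ballx x d d0)) => y.
by rewrite -ball_normE /ball_ /= => /Hd.
Qed.

Lemma epsilon_continuous (R : realType) (V : normedModType R) (f : V -> R) :
  (forall (x : V) (eps : R), 0 < eps -> exists2 d : R, 0 < d & forall y, `|x - y| < d ->
    `|f x - f y| < eps) -> continuous f.
Proof. by move=> H x; apply: epsilon_continuous_at => eps; exact: H. Qed.

Lemma continuous_translate (R : realType) (V : normedModType R) (g : V -> R)
  (x : V) : continuous g -> continuous (fun y => g (y - x)).
Proof.
move=> cg; apply: epsilon_continuous => y eps eps0.
have cgx : g z @[z --> y - x] --> g (y - x) by exact: cg.
move/cvgrPdist_lt : cgx => /(_ _ eps0).
rewrite -nbhs_ballE => -[d /= d0 Hd]; exists d => // z yz; apply: Hd.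
by rewrite -ball_normE /ball_ /= opprB addrA subrK.
Qed.

Section correlation.
Context {R : realType} {n : nat}.
Local Notation rV := 'rV[R]_n.
Local Notation mu := (@lebesgue_rV R n).

(** Cross-correlation rather than convolution: with g (y - x) in place of
    g (x - y) one needs the invariance of the measure under translations only,
    not under reflection. *)
Definition corr (w g : rV -> R) (x : rV) : R := \int[mu]_y (w y * g (y - x)).

Variables (K : set rV) (w : rV -> R).
Hypotheses (cK : compact K) (cw : continuous w) (w0 : forall x, ~ K x -> w x = 0).

Let iw : R := \int[mu]_y `|w y|.

Let wi : mu.-integrable setT (EFin \o w).
Proof. exact: supported_integrable w0. Qed.

Let iw_ge0 : 0 <= iw. Proof. by apply: Rintegral_ge0 => x _. Qed.

Lemma continuous_mulr_shift (g : rV -> R) (x : rV) : continuous g ->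
  continuous (fun y => w y * g (y - x)).
Proof.
by move=> cg y; apply: continuousM; [exact: cw|exact: continuous_translate].
Qed.

Lemma corr_integrable (g : rV -> R) (x : rV) : continuous g ->
  mu.-integrable setT (EFin \o (fun y => w y * g (y - x))).
Proof.
move=> cg; apply: (supported_integrable cK); first exact: continuous_mulr_shift.
by move=> y /w0 ->; rewrite mul0r.
Qed.

Lemma le_corr_norm (h : rV -> R) (eps : R) : 0 <= eps ->
  mu.-integrable setT (EFin \o (fun y => w y * h y)) ->
  (forall y, `|h y| <= eps) -> `|\int[mu]_y (w y * h y)| <= eps * iw.
Proof.
move=> eps0 hi heps.
apply: (le_trans (le_normr_Rintegral measurableT hi)).
rewrite -RintegralZl//; last exact: rintegrable_norm.
apply: le_Rintegral => //.
- exact: rintegrable_norm.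
- by apply: rintegrableZ => //; exact: rintegrable_norm.
- by move=> y _; rewrite normrM mulrC ler_wpM2r.
Qed.

Section kernel.
Variables (L : set rV) (g : rV -> R).
Hypotheses (cL : compact L) (cg : continuous g) (g0 : forall x, ~ L x -> g x = 0).

Lemma corr_continuous : continuous (corr w g).
Proof.
apply: epsilon_continuous => x eps eps0.
have e0 : 0 < eps / (iw + 1) by rewrite divr_gt0// ltr_wpDl.
have [d d0 Hd] := supported_unif_continuous cL cg g0 e0.
exists d => // x' xx'.
rewrite /corr -RintegralB//; [|exact: corr_integrable..].
under eq_Rintegral do rewrite -mulrBr.
rewrite (le_lt_trans (le_corr_norm (ltW e0) _ _))//.
- under eq_fun do rewrite /= mulrBr.
  by apply: rintegrableB => //; exact: corr_integrable.
- move=> y; apply/ltW/Hd.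
  by rewrite opprB [X in `|X|]addrC addrA subrK distrC.
- by rewrite mulrAC ltr_pdivrMr ?ltr_wpDl// ltr_pM2l// ltrDl.
Qed.

Lemma corr_is_derive (dg : rV -> R) (e x : rV) : continuous dg ->
  (forall y, is_derive y e g (dg y)) -> is_derive x e (corr w g) (- corr w dg x).
Proof.
move=> cdg gd.
have dg0 := is_derive_supported cL gd g0.
apply: is_derive_epsilon => eps eps0.
have e0 : 0 < eps / (iw + 1) by rewrite divr_gt0// ltr_wpDl.
have [d d0 Hd] := unif_difference_quotient gd (supported_unif_continuous cL cdg dg0) e0.
exists d => // t t0 td; rewrite opprK.
have gi z := corr_integrable z cg.
have dgi := corr_integrable x cdg.
have bi : mu.-integrable setT
    (EFin \o (fun y => w y * g (y - (t *: e + x)) - w y * g (y - x))).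
  exact: rintegrableB.
have ti : mu.-integrable setT
    (EFin \o (fun y => t^-1 * (w y * g (y - (t *: e + x)) - w y * g (y - x)))).
  exact: rintegrableZ.
rewrite /corr -RintegralB// -RintegralZl// -RintegralD//.
pose h y := t^-1 * (g (y - (t *: e + x)) - g (y - x)) + dg (y - x).
have E y : t^-1 * (w y * g (y - (t *: e + x)) - w y * g (y - x)) +
    w y * dg (y - x) = w y * h y.
  by rewrite /h; ring.
under eq_Rintegral do rewrite E.
rewrite (le_lt_trans (le_corr_norm (ltW e0) _ _))//.
- under eq_fun do rewrite /= -E.
  exact: rintegrableD.
- move=> y; rewrite /h.
  have := Hd (- t) (y - x); rewrite oppr_eq0 normrN => /(_ t0 td) H.
  apply: ltW; apply: le_lt_trans H.
  have -> : - t *: e + (y - x) = y - (t *: e + x).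
    by rewrite scaleNr opprD addrCA.
  by rewrite invrN mulNr -opprD normrN.
- by rewrite mulrAC ltr_pdivrMr ?ltr_wpDl// ltr_pM2l// ltrDl.
Qed.

(** Integration by parts moves the derivative from the kernel g to w. *)
Lemma corr_is_derive_swap (dw dg : rV -> R) (e x : rV) : continuous dg ->
  continuous dw -> (forall y, is_derive y e w (dw y)) ->
  (forall y, is_derive y e g (dg y)) -> is_derive x e (corr w g) (corr dw g x).
Proof.
move=> cdg cdw wd gd.
have := corr_is_derive x cdg gd; congr (is_derive _ _ _ _).
pose X y := w y * g (y - x).
pose dX y := w y * dg (y - x) + g (y - x) * dw y.
have gx y : is_derive y e (fun y => g (y - x)) (dg (y - x)).
  have E z : z - x = 0 *: e + (z - x) by rewrite scale0r add0r.
  have H0 : is_derive (0 : R) 1 (fun s => g (s *: e + (y - x))) (dg (y - x)).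
    by apply/(is_derive_slice g (y - x) e); rewrite scale0r add0r.
  rewrite -[y in is_derive y _ _ _]add0r -(scale0r e).
  apply/(is_derive_slice (fun y => g (y - x)) y e).
  by under eq_fun do rewrite -addrA.
have Xd y : is_derive y e X (dX y) by exact: (is_deriveM (wd y) (gx y)).
have cdX : continuous dX.
  move=> y; have c1 := @continuous_mulr_shift dg x cdg y.
  have c2 := @continuous_translate R rV g x cg y.
  have c3 := continuousM c2 (cdw y).
  exact: (continuousD c1 c3).
have X0 y : ~ K y -> X y = 0 by rewrite /X => /w0 ->; rewrite mul0r.
have := integral_is_derive_supported cK (@continuous_mulr_shift g x cg) cdX Xd X0.
have dw0 := is_derive_supported cK wd w0.
have dwgi : mu.-integrable setT (EFin \o (fun y => dw y * g (y - x))).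
  apply: (supported_integrable cK); last by move=> y /dw0 ->; rewrite mul0r.
  by move=> y; have := continuousM (cdw y) (@continuous_translate R rV g x cg y).
have wdgi := corr_integrable x cdg.
rewrite /dX RintegralD//; last first.
  by apply: eq_rintegrable dwgi => // y _; rewrite mulrC.
rewrite /corr => /eqP; rewrite addrC addr_eq0 => /eqP <-.
by apply: eq_Rintegral => y _; rewrite mulrC.
Qed.

(** If g has mean one and lives in a ball of radius r, then corr w g x is an
    average of values of w within r of x. *)
Lemma corr_approx (eps r : R) : 0 <= eps ->
  (forall y, 0 <= g y) -> \int[mu]_y g y = 1 -> (forall y, r <= `|y| -> g y = 0) ->
  (forall x y, `|x - y| < r -> `|w x - w y| <= eps) ->
  forall x, `|corr w g x - w x| <= eps.
Proof.
move=> eps0 g_ge0 ig gr we x.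
have gi : mu.-integrable setT (EFin \o g) by exact: supported_integrable g0.
have gxi : mu.-integrable setT (EFin \o (fun y => g (y - x))).
  exact: integrable_translation.
have igx : \int[mu]_y g (y - x) = 1 by rewrite Rintegral_translation.
rewrite -[X in _ - X]mulr1 -igx -RintegralZl//.
have wxgi : mu.-integrable setT (EFin \o (fun y => w x * g (y - x))).
  exact: rintegrableZ.
have wgi := corr_integrable x cg.
rewrite /corr -RintegralB//.
apply: (le_trans (le_normr_Rintegral measurableT _)); first exact: rintegrableB.
rewrite -[leRHS]mulr1 -igx -RintegralZl//.
apply: le_Rintegral => //.
- by apply: rintegrable_norm => //; exact: rintegrableB.
- exact: rintegrableZ.
move=> y _; rewrite -mulrBl normrM (ger0_norm (g_ge0 _)).
have [yr|yr] := leP r `|y - x|; first by rewrite gr// !mulr0.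
by rewrite ler_wpM2r//; exact: we.
Qed.

End kernel.
End correlation.

(** * Mollification *)

Section mollifier.
Context {R : realType} {n : nat}.
Local Notation rV := 'rV[R]_n.
Local Notation mu := (@lebesgue_rV R n).
Local Notation e i := (delta_mx ord0 i : rV).

Lemma compact_norm_le (r : R) : compact [set y : rV | `|y| <= r].
Proof.
apply: bounded_closed_compact.
  exists r; split; rewrite ?num_real// => s rs y /= yr.
  exact: le_trans yr (ltW rs).
have : closed ((fun y : rV => `|y|) @^-1` [set x | x <= r]).
  apply: closed_comp; last exact: closed_le.
  by move=> y _; exact: norm_continuous.
by [].
Qed.

Lemma supported_integral_gt0 (K : set rV) (f : rV -> R) (x : rV) : compact K ->
  continuous f -> (forall y, ~ K y -> f y = 0) -> (forall y, 0 <= f y) ->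
  0 < f x -> 0 < \int[mu]_y f y.
Proof.
move=> cK cf f0 f_ge0 fx.
have e0 : 0 < f x / 2 by rewrite divr_gt0.
have [d d0 Hd] := supported_unif_continuous cK cf f0 e0.
pose B : set rV := ball x d.
have mB : measurable B by exact: measurable_ball_rV.
have fi := supported_integrable cK cf f0.
have Blty : (mu B < +oo)%E by exact: lebesgue_rV_ball_lty.
have Bi : mu.-integrable setT (EFin \o (\1_B : rV -> R)).
  apply/integrableP; split; first exact/measurable_EFinP.
  rewrite (eq_integral (fun y => (\1_B y)%:E)); last first.
    by move=> t _; rewrite gee0_abs// lee_fin.
  by rewrite integral_indic// setIT.
have I1 : \int[mu]_y (\1_B : rV -> R) y = fine (mu B).
  by rewrite /Rintegral integral_indic// setIT.
have Bgt0 : 0 < fine (mu B).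
  by rewrite fine_gt0// Blty lebesgue_rV_ball_gt0.
apply: (@lt_le_trans _ _ (f x / 2 * fine (mu B))); first by rewrite mulr_gt0.
rewrite -I1 -RintegralZl//; apply: le_Rintegral => //.
  exact: rintegrableZ.
move=> y _; rewrite indicE; case: (boolP (y \in B)) => [/set_mem yB|_].
  rewrite /= mulr1; have : `|f x - f y| < f x / 2.
    by apply: Hd; move: yB; rewrite /B -ball_normE.
  rewrite ltr_norml => /andP[_ H].
  lra.
by rewrite mulr0.
Qed.

Definition kernel_at (r : R) (k : rV -> R) :=
  [/\ smooth_on setT k, forall y, 0 <= k y, \int[mu]_y k y = 1
    & forall y, r <= `|y| -> k y = 0].

Lemma smooth_continuous (f : rV -> R) : smooth_on setT f -> continuous f.
Proof. by move=> sf x; have [] := sf 0%N [::] x isT I. Qed.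

(** A mollifier is obtained from any nonzero test function eta: square it to
    make it nonnegative, rescale it around a point where it does not vanish,
    and normalize. *)
Lemma exists_kernel (K : set rV) (eta : rV -> R) (x1 : rV) : smooth_on setT eta ->
  compact K -> (forall x, ~ K x -> eta x = 0) -> eta x1 != 0 ->
  forall r : R, 0 < r -> exists k, kernel_at r k.
Proof.
move=> se cK eta0 etax1 r r0.
have [M [_ KM]] := compact_bounded cK.
pose M' : R := `|M| + 1.
have KM' x : K x -> `|x| <= M'.
  by apply: KM; rewrite ltr_pwDr// ler_norm.
(* a r >= M' + |x1| + 1, so |y| >= r sends a y + x1 out of the ball of
   radius M', which contains the support of eta *)
pose a : R := (M' + `|x1| + 1) / r.
have a0 : 0 < a.
  by rewrite divr_gt0// ltr_wpDl// addr_ge0// addr_ge0.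
pose g (y : rV) := eta (a *: y + x1) * eta (a *: y + x1).
have sg : smooth_on setT g by move=> k; apply: CkM; apply: Ck_affine; exact: se.
have cg := smooth_continuous sg.
have gr y : r <= `|y| -> g y = 0.
  move=> yr; rewrite /g eta0 ?mul0r// => /KM'; apply/negP; rewrite -ltNge.
  have : a * r <= `|a *: y|.
    by rewrite normrZ gtr0_norm// ler_pM2l.
  rewrite /a divfK ?gt_eqF// => H.
  have := lerB_normD (a *: y) x1.
  lra.
have g_ge0 y : 0 <= g y by rewrite /g -expr2 sqr_ge0.
have cB := @compact_norm_le r.
have gB y : ~ `|y| <= r -> g y = 0.
  by move=> /negP; rewrite -ltNge => /ltW /gr.
have gi := supported_integrable cB cg gB.
have ig : 0 < \int[mu]_y g y.
  apply: (supported_integral_gt0 (x := 0) cB cg gB g_ge0).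
  by rewrite /g scaler0 add0r -expr2 lt0r sqr_ge0 sqrf_eq0 etax1.
exists (fun y => (\int[mu]_y g y)^-1 * g y); split.
- by move=> k; apply: CkM; [exact: Ck_cst|exact: sg].
- by move=> y; rewrite mulr_ge0// invr_ge0 ltW.
- by rewrite RintegralZl// mulVf// gt_eqF.
- by move=> y /gr ->; rewrite mulr0.
Qed.

Lemma corr_Ck (K : set rV) (w : rV -> R) (L : set rV) (g : rV -> R) k :
  compact K -> continuous w -> (forall x, ~ K x -> w x = 0) ->
  compact L -> (forall x, ~ L x -> g x = 0) ->
  Ck_on k setT g -> Ck_on k setT (corr w g).
Proof.
move=> cK cw w0 cL; elim: k g => [|k IH] g g0.
  move=> Hg [|//] x _ _; split => //.
  have cg : continuous g by move=> y; have [] := Hg [::] y isT I.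
  exact: (corr_continuous cK cw w0 cL cg g0).
move=> /CkS[cg Hg]; apply/CkS; split.
  exact: (corr_continuous cK cw w0 cL cg g0).
move=> i.
have gd y : is_derive y (e i) g (partial i g y).
  by apply: is_derive_partial; exact: (Hg i).1.
have pg0 := is_derive_supported cL gd g0.
have cpg : continuous (partial i g).
  by move=> y; have [] := (Hg i).2 [::] y isT I.
have D x : is_derive x (e i) (corr w g) (- 1 * corr w (partial i g) x).
  by rewrite mulN1r; exact: (corr_is_derive cK cw w0 cL cg g0).
split=> [x|]; first by case: (D x).
rewrite (partialE D); apply: CkM; first exact: Ck_cst.
by apply: IH => //; exact: (Hg i).2.
Qed.

(** A compact subset of an open set stays at positive distance from the
    complement. *)
Lemma compact_margin (K Omega : set rV) : compact K -> open Omega ->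
  K `<=` Omega -> exists2 d : R, 0 < d & forall x y, K x -> `|x - y| < d -> Omega y.
Proof.
move=> cK oO KO.
have H : \forall d \near (0:R)^'+, K `<=` [set x | forall y, `|x - y| < d -> Omega y].
  apply: (proj1 (compact_near_coveringP K) cK R (0:R)^'+
    (fun d x => forall y, `|x - y| < d -> Omega y)) => x Kx.
  have := open_nbhs_nbhs (conj oO (KO x Kx)).
  rewrite -nbhs_ballE => -[r /= r0 rf].
  have r20 : 0 < r / 2 by rewrite divr_gt0.
  exists (ball x (r / 2), [set d | d < r / 2]) => /=.
    split; first exact: nbhsx_ballx.
    near=> d => /=; near: d; exact: nbhs_right_lt.
  move=> [x' d] /= [xx' dr] y x'y.
  apply: rf; rewrite -ball_normE /ball_ /= (splitr r).
  rewrite -(subrK x' x) -addrA (le_lt_trans (ler_normD _ _))// ltrD//.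
    by move: xx'; rewrite -ball_normE.
  exact: lt_trans dr.
near (0:R)^'+ => d; exists d; first by [].
by move=> x y Kx xy; have dK := near H d; apply: (dK _ x).
Unshelve. all: end_near. Qed.

(** Functions of class C^1 with compact support in Omega, packaged with their
    gradient so that derivatives are given by formulas instead of by the
    operator partial. *)
Definition C1c (Omega : set rV) (w : rV -> R) (dw : 'I_n -> rV -> R) :=
  exists K, [/\ compact K, K `<=` Omega & forall x, ~ K x -> w x = 0] /\
  [/\ continuous w, forall i, continuous (dw i)
    & forall i x, is_derive x (e i) w (dw i x)].

(** Mollification: the radius r is below the moduli of continuity of w and of
    its gradient for the precision eps, and below half the distance of the
    support to the complement of Omega, so that the support stays inside. *)
Lemma C1c_approx (Omega : set rV) w dw (eps : R) : open Omega -> C1c Omega w dw ->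
  (forall r : R, 0 < r -> exists k, kernel_at r k) -> 0 < eps ->
  exists psi, [/\ test_function Omega psi, forall x, `|psi x - w x| <= eps
    & forall i x, `|partial i psi x - dw i x| <= eps].
Proof.
move=> oO [K [[cK KO w0] [cw cdw wd]]] Hk eps0.
have dw0 i := is_derive_supported cK (wd i) w0.
have [m m0 Km] := compact_margin cK oO KO.
have [d1 d10 H1] := supported_unif_continuous cK cw w0 eps0.
have /choice[d2 H2] : forall i, exists d, 0 < d /\
    forall x y, `|x - y| < d -> `|dw i x - dw i y| < eps.
  move=> i; have [d d0 Hd] := supported_unif_continuous cK (cdw i) (dw0 i) eps0.
  by exists d.
pose r := Num.min (m / 2) (\big[Num.min/d1]_i d2 i).
have r0 : 0 < r.
  rewrite lt_min divr_gt0//=; elim/big_ind: _ => // [x y x0 y0|i _].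
    by rewrite lt_min x0.
  exact: (H2 i).1.
have rm : r <= m / 2 by rewrite ge_min lexx.
have rd1 : r <= d1.
  by rewrite ge_min; apply/orP; right; exact: bigmin_le_id.
have rd2 i : r <= d2 i.
  by rewrite ge_min; apply/orP; right; exact: bigmin_le.
have [k [sk k_ge0 ik kr]] := Hk r r0.
have cB := @compact_norm_le r.
have ck := smooth_continuous sk.
have k0 y : ~ `|y| <= r -> k y = 0.
  by move=> /negP; rewrite -ltNge => /ltW /kr.
pose psi := corr w k.
have spsi : smooth_on setT psi.
  by move=> j; exact: (corr_Ck cK cw w0 cB k0 (sk j)).
have psi_supp x : psi x != 0 -> exists2 y, K y & `|y - x| < r.
  move=> /eqP px; apply: contrapT => H; apply: px.
  rewrite /psi /corr (_ : (fun y => _) = cst 0).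
    by rewrite Rintegral_cst// mul0r.
  apply/funext => y /=.
  have [Ky|Ky] := pselect (K y); last by rewrite w0// mul0r.
  rewrite kr ?mulr0// leNgt; apply/negP => yxr; apply: H; by exists y.
have clpsi x : closure [set x | psi x != 0] x -> exists2 y, K y & `|y - x| < m.
  move=> /(_ _ (nbhsx_ballx x (m / 2) (divr_gt0 m0 (ltr0n _ 2)))).
  move=> [z [/= /psi_supp[y Ky yz]]].
  rewrite -ball_normE /ball_ /= => xz; exists y => //.
  rewrite (splitr m) -(subrK z y) -addrA (le_lt_trans (ler_normD _ _))// ltrD//.
    exact: lt_le_trans rm.
  by rewrite distrC.
exists psi; split.
- split => //.
    apply: bounded_closed_compact; last exact: closed_closure.
    have [M [_ KM]] := compact_bounded cK.
    exists (`|M| + 1 + m); split; rewrite ?num_real// => s Ms x /clpsi[y Ky yx] /=.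
    apply: le_trans (ltW Ms).
    rewrite -(subrK y x) addrC (le_trans (ler_normD _ _))// lerD//.
      by apply: KM => //; rewrite ltr_pwDr// ler_norm.
    by rewrite distrC ltW.
  by move=> x /clpsi[y Ky yx]; exact: Km yx.
- move=> x; apply: (corr_approx cK cw w0 cB ck k0 (ltW eps0) k_ge0 ik kr).
  by move=> y z yz; apply/ltW/H1; exact: lt_le_trans rd1.
- move=> i x.
  have kd y : is_derive y (e i) k (partial i k y).
    by apply: is_derive_partial; have [_ /(_ isT)] := sk 1%N [::] y isT I.
  have cdk : continuous (partial i k).
    by move=> y; have [] := sk 1%N [:: i] y isT I.
  have D y := corr_is_derive_swap cK cw w0 cB ck k0 y cdk (cdw i) (wd i) kd.
  rewrite (partialE D).
  apply: (corr_approx cK (cdw i) (dw0 i) cB ck k0 (ltW eps0) k_ge0 ik kr).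
  by move=> y z yz; apply/ltW/(H2 i).2; exact: lt_le_trans (rd2 i).
Qed.

End mollifier.

(** * Square integrable functions and H^1_0 *)

Section square_integrable.
Context {R : realType} {n : nat}.
Local Notation rV := 'rV[R]_n.
Local Notation mu := (@lebesgue_rV R n).
Local Notation e i := (delta_mx ord0 i : rV).
Variable Omega : set rV.
Hypotheses (oO : open Omega) (bO : bounded_set Omega).
Local Notation intg f := (mu.-integrable Omega (EFin \o f)).
Implicit Types f g : rV -> R.

Let mO : measurable Omega. Proof. exact: open_measurable_rV. Qed.

Let Olty : (mu Omega < +oo)%E. Proof. exact: bounded_set_rV_lty. Qed.

Definition L2 f := measurable_fun Omega f /\ intg (fun x => f x ^+ 2).

Lemma L2_bounded f M : measurable_fun Omega f ->
  (forall x, Omega x -> `|f x| <= M) -> L2 f.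
Proof.
move=> mf fM; split => //; apply: (@rintegrable_bounded _ _ _ _ _ mO _ (M ^+ 2)) => //.
  exact: measurable_funX.
move=> x Ox; rewrite normrX lerXn2r ?nnegrE//; last exact: fM.
exact: le_trans (fM x Ox).
Qed.

Lemma L2M f g : L2 f -> L2 g -> intg (fun x => f x * g x).
Proof.
move=> [mf fi] [mg gi].
apply: (@le_rintegrable _ _ _ _ _ mO _ (fun x => f x ^+ 2 + g x ^+ 2)).
- exact: measurable_funM.
- move=> x _; rewrite normrM -(real_normK (num_real (f x))) -(real_normK (num_real (g x))).
  have := sqr_ge0 (`|f x| - `|g x|); have := sqr_ge0 (`|f x| + `|g x|); nra.
- exact: rintegrableD.
Qed.

Lemma L2D f g : L2 f -> L2 g -> L2 (fun x => f x + g x).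
Proof.
move=> L2f L2g; split; first by apply: measurable_funD; [case: L2f|case: L2g].
have fi := L2f.2; have gi := L2g.2; have fgi := L2M L2f L2g.
have H := rintegrableD mO (rintegrableD mO fi gi) (rintegrableZ mO 2 fgi).
by apply: (eq_rintegrable mO _ H) => x _; ring.
Qed.

Lemma L2N f : L2 f -> L2 (fun x => - f x).
Proof.
move=> [mf fi]; split; first exact: measurable_funN.
by apply: (eq_rintegrable mO _ fi) => x _; rewrite sqrrN.
Qed.

Lemma L2_int f : L2 f -> intg f.
Proof.
move=> L2f; have L21 : L2 (cst 1).
  by apply: (@L2_bounded _ 1) => // x _; rewrite normr1.
by apply: (eq_rintegrable mO _ (L2M L2f L21)) => x _; rewrite mulr1.
Qed.

Lemma L2_norm f : L2 f -> L2 (fun x => `|f x|).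
Proof.
move=> [mf fi]; split; first exact: measurableT_comp.
by apply: (eq_rintegrable mO _ fi) => x _; rewrite real_normK ?num_real.
Qed.

Lemma L2_supported (K : set rV) f : compact K -> continuous f ->
  (forall x, ~ K x -> f x = 0) -> L2 f.
Proof.
move=> cK cf f0; have [M M0 fM] := supported_bounded cK cf f0.
by apply: (@L2_bounded _ M) => //; apply: (supported_measurable cf).
Qed.

Lemma cvg_integral_sqr (F : nat -> rV -> R) :
  (forall m, measurable_fun Omega (F m)) ->
  (forall m x, `|F m x| <= m.+1%:R^-1) ->
  (\int[mu]_(x in Omega) ((F m x) ^+ 2)%:E)%E @[m --> \oo] --> 0%E.
Proof.
move=> mF FM.
have fO : mu Omega \is a fin_num by rewrite ge0_fin_numE.
apply: (@squeeze_cvge _ _ _ _ (cst 0%E) _ (fun m => (harmonic m * fine (mu Omega))%:E)).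
- apply: nearW => m; apply/andP; split.
    by apply: integral_ge0 => x _; rewrite lee_fin sqr_ge0.
  rewrite EFinM fineK// -integral_cst//; apply: ge0_le_integral => //.
  + by move=> x _; rewrite lee_fin sqr_ge0.
  + by apply/measurable_EFinP; exact: measurable_funX.
  + move=> x _; rewrite lee_fin /harmonic -real_normK ?num_real//.
    apply: (@le_trans _ _ (`|F m x| * 1)).
      rewrite expr2 ler_wpM2l//; apply: le_trans (FM m x) _.
      by rewrite invf_le1// ler1n.
    by rewrite mulr1.
- exact: cvg_cst.
- apply/fine_cvgP; split; first exact: nearW.
  rewrite -[X in _ --> X](mul0r (fine (mu Omega))).
  by apply: cvgM; [exact: cvg_harmonic|exact: cvg_cst].
Qed.

(** This makes C^1 functions with compact support, such as those built from a
    C^2 solution, admissible in the weak eigenvalue equation, whose test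
    functions are H^1 limits of smooth ones. *)
Lemma C1c_H10_grad w dw : (forall r : R, 0 < r -> exists k : rV -> R, kernel_at r k) ->
  C1c Omega w dw -> H10_grad Omega w dw.
Proof.
move=> Hk cw; have [K [[cK KO w0] [cow cdw wd]]] := cw.
split.
- exact: supported_measurable.
- by move=> i; exact: supported_measurable.
have /choice[psi Hpsi] : forall m : nat, exists psi,
    [/\ test_function Omega psi, forall x, `|psi x - w x| <= m.+1%:R^-1
    & forall i x, `|partial i psi x - dw i x| <= m.+1%:R^-1].
  by move=> m; apply: (C1c_approx oO cw Hk); rewrite invr_gt0.
have cpsi m : continuous (psi m) by case: (Hpsi m) => -[/smooth_continuous].
have cdpsi m i : continuous (partial i (psi m)).
  by move=> x; case: (Hpsi m) => -[/(_ 1%N [:: i] x isT I)[]].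
exists psi; split=> [m|//|i].
- by case: (Hpsi m).
- apply: cvg_integral_sqr => [m|m x]; last by case: (Hpsi m).
  by apply: measurable_funB; exact: supported_measurable.
- apply: cvg_integral_sqr => [m|m x]; last by case: (Hpsi m).
  by apply: measurable_funB; exact: supported_measurable.
Qed.

Lemma test_function_C1c psi : test_function Omega psi -> C1c Omega psi (partial ^~ psi).
Proof.
move=> [spsi cS SO]; exists (closure [set x | psi x != 0]); split; split => //.
- move=> x Hx; apply/eqP; apply: contrapT => /negP px; apply: Hx.
  exact: subset_closure.
- exact: smooth_continuous.
- by move=> i x; have [] := spsi 1%N [:: i] x isT I.
- by move=> i x; apply: is_derive_partial; have [_ /(_ isT)] := spsi 1%N [::] x isT I.
Qed.

Definition H1_close (eps : R) (u : rV -> R) (G : 'I_n -> rV -> R) (psi : rV -> R) :=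
  [/\ test_function Omega psi,
      L2 (fun x => psi x - u x) /\ \int[mu]_(x in Omega) (psi x - u x) ^+ 2 <= eps
    & forall i, L2 (fun x => partial i psi x - G i x) /\
        \int[mu]_(x in Omega) (partial i psi x - G i x) ^+ 2 <= eps].

Lemma integral_sqr_close (f : rV -> R) (eps : R) : measurable_fun Omega f ->
  (\int[mu]_(x in Omega) (f x ^+ 2)%:E < eps%:E)%E ->
  L2 f /\ \int[mu]_(x in Omega) f x ^+ 2 <= eps.
Proof.
move=> mf feps.
have I0 : (0 <= \int[mu]_(x in Omega) (f x ^+ 2)%:E)%E.
  by apply: integral_ge0 => x _; rewrite lee_fin sqr_ge0.
split.
  split => //; apply/integrableP; split.
    by apply/measurable_EFinP; exact: measurable_funX.
  rewrite (eq_integral (fun x => (f x ^+ 2)%:E)); last first.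
    by move=> x _ /=; rewrite ger0_norm// sqr_ge0.
  exact: lt_trans feps (ltry _).
rewrite /Rintegral -lee_fin fineK; first exact: ltW.
by rewrite ge0_fin_numE//; exact: lt_trans feps (ltry _).
Qed.

Lemma H10_close (u : rV -> R) (G : 'I_n -> rV -> R) (eps : R) : 0 < eps ->
  H10_grad Omega u G -> exists psi, H1_close eps u G psi.
Proof.
move=> eps0 [mu_ mG [phi [tphi c0 ci]]].
have H (I_ : (\bar R)^nat) : I_ k @[k --> \oo] --> 0%E ->
    \forall k \near \oo, (I_ k < eps%:E)%E.
  move=> /fine_cvgP[fin0 /cvgr_lt/(_ _ eps0)]; apply: filterS2 fin0 => k kfin.
  by rewrite -lte_fin fineK.
have H0 := H _ c0.
have Hi : \forall k \near \oo, forall i,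
    (\int[mu]_(x in Omega) ((partial i (phi k) x - G i x) ^+ 2)%:E < eps%:E)%E.
  by apply: filter_forall => i; exact: H (ci i).
near \oo => k.
have mphi : measurable_fun Omega (phi k).
  have [/smooth_continuous cphi _ _] := tphi k.
  exact: supported_measurable.
exists (phi k); split => //.
  apply: integral_sqr_close; first exact: measurable_funB.
  by near: k.
move=> i; apply: integral_sqr_close.
  apply: measurable_funB => //; apply: supported_measurable => x.
  by have [/(_ 1%N [:: i] x isT I)[]] := tphi k.
by move: i; near: k.
Unshelve. all: end_near. Qed.

(** The Cauchy-Schwarz inequality, in a form that needs no square root: the
    parameter s is optimized by the user. *)
Lemma L2_young f g (s : R) : 0 < s -> L2 f -> L2 g ->
  \int[mu]_(x in Omega) (f x * g x) <=
  s / 2 * \int[mu]_(x in Omega) f x ^+ 2 + (2 * s)^-1 * \int[mu]_(x in Omega) g x ^+ 2.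
Proof.
move=> s0 L2f L2g; have [_ fi] := L2f; have [_ gi] := L2g.
have sfi := rintegrableZ mO (s / 2) fi; have sgi := rintegrableZ mO (2 * s)^-1 gi.
rewrite -!RintegralZl// -RintegralD//.
apply: le_Rintegral => //; [exact: L2M|exact: rintegrableD|].
move=> x _; rewrite -subr_ge0.
rewrite (_ : _ - _ = (2 * s)^-1 * (s * f x - g x) ^+ 2).
  by rewrite mulr_ge0 ?sqr_ge0// invr_ge0 mulr_ge0// ltW.
field; rewrite gt_eqF//.
Qed.

(** Young's inequality between u and the constant 1 bounds the mean of u by a
    quantity below 1 when u vanishes in L^2. *)
Lemma integral_sqr_gt0 (u : rV -> R) : L2 u ->
  \int[mu]_(x in Omega) u x = 1 -> 0 < \int[mu]_(x in Omega) u x ^+ 2.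
Proof.
move=> L2u iu; set I := \int[mu]_(x in Omega) _ ^+ 2.
have I0 : 0 <= I by apply: Rintegral_ge0 => x _; exact: sqr_ge0.
rewrite lt_neqAle I0 andbT; apply/eqP => I00.
have L21 : L2 (cst 1) by apply: (@L2_bounded _ 1) => // x _; rewrite normr1.
pose m := fine (mu Omega).
have m0 : 0 <= m by exact: fine_ge0.
have s0 : 0 < (m + 1)^-1 by rewrite invr_gt0 ltr_wpDl.
have := L2_young s0 L21 L2u; rewrite -/I -I00 mulr0 addr0.
under eq_Rintegral do rewrite mul1r.
under [X in _ <= _ * X -> _]eq_Rintegral do rewrite expr1n.
rewrite iu Rintegral_cst// mul1r -/m => H.
have : (m + 1)^-1 / 2 * m <= 2^-1.
  rewrite mulrAC ler_piMl// mulrC ler_pdivrMr ?ltr_wpDl// mul1r lerDl//.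
by move=> /(le_trans H); lra.
Qed.

Lemma H10_L2 u G : H10_grad Omega u G -> L2 u /\ forall i, L2 (G i).
Proof.
move=> H; have [psi [tpsi [L2u _] L2G]] := H10_close ltr01 H.
have [K [[cK KO psi0] [cpsi cdpsi psid]]] := test_function_C1c tpsi.
split.
  have := L2D (L2_supported cK cpsi psi0) (L2N L2u).
  by under eq_fun do rewrite opprB addrC subrK.
move=> i; have [/L2N L2Gi _] := L2G i.
have := L2D (L2_supported cK (cdpsi i) (is_derive_supported cK (psid i) psi0)) L2Gi.
by under eq_fun do rewrite opprB addrC subrK.
Qed.

Lemma exists_test_function_neq0 u G : H10_grad Omega u G ->
  \int[mu]_(x in Omega) u x = 1 ->
  exists psi, test_function Omega psi /\ exists x, psi x != 0.
Proof.
move=> H iu; have [L2u _] := H10_L2 H.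
have I0 := integral_sqr_gt0 L2u iu.
have [|psi [tpsi [_ close] _]] := @H10_close u G (\int[mu]_(x in Omega) u x ^+ 2 / 2) _ H.
  by rewrite divr_gt0.
exists psi; split => //; apply: contrapT => /forallNP psi0.
have : \int[mu]_(x in Omega) (psi x - u x) ^+ 2 = \int[mu]_(x in Omega) u x ^+ 2.
  apply: eq_Rintegral => x _; have /negP/negPn/eqP -> := psi0 x.
  by rewrite sub0r sqrrN.
move=> E; move: close; rewrite E; lra.
Qed.

(** A function of mean one in H^1_0 cannot be approximated by zero alone, so
    there is a nonzero test function from which to build mollifiers. *)
Lemma exists_kernel_H10 u G : H10_grad Omega u G ->
  \int[mu]_(x in Omega) u x = 1 ->
  forall r : R, 0 < r -> exists k : rV -> R, kernel_at r k.
Proof.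
move=> H iu; have [psi [tpsi [x psix]]] := exists_test_function_neq0 H iu.
have [K [[cK KO psi0] _]] := test_function_C1c tpsi.
by apply: (exists_kernel (x1 := x)) psi0 psix => //; case: tpsi.
Qed.

(** Test the equation of u with u itself. *)
Lemma eigenpair_ge0 (l : R) u : dirichlet_eigenpair Omega l u ->
  \int[mu]_(x in Omega) u x = 1 -> 0 <= l.
Proof.
move=> [G HG /(_ _ _ HG) E] iu; have [L2u _] := H10_L2 HG.
have I0 := integral_sqr_gt0 L2u iu.
rewrite -(pmulr_lge0 _ I0); under eq_Rintegral do rewrite expr2.
rewrite -E; apply: Rintegral_ge0 => x _; apply: sumr_ge0 => i _.
by rewrite -expr2 sqr_ge0.
Qed.

End square_integrable.

(** * Products and compositions with compact support *)

Section smooth_sign.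
Context {R : realType}.
Variable d : R.
Hypothesis d0 : 0 < d.

(** A smooth approximation of the absolute value: ssgn, its derivative, is a
    smooth increasing approximation of the sign, and dssgn the derivative of
    ssgn. Being even, sabs - d is nonnegative without any sign condition on
    its argument. *)
Definition sabs (t : R) : R := Num.sqrt (d ^+ 2 + t ^+ 2).
Definition ssgn (t : R) : R := t / sabs t.
Definition dssgn (t : R) : R := d ^+ 2 / sabs t ^+ 3.

Let p0 t : 0 < d ^+ 2 + t ^+ 2.
Proof. by rewrite ltr_pwDl ?exprn_gt0// sqr_ge0. Qed.

Lemma sabs_sqr t : sabs t ^+ 2 = d ^+ 2 + t ^+ 2.
Proof. by rewrite sqr_sqrtr// ltW. Qed.

Lemma sabs_ge t : d <= sabs t.
Proof.
rewrite -(@ler_pXn2r _ 2)// ?nnegrE ?sqrtr_ge0 ?(ltW d0)// sabs_sqr.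
by rewrite lerDl sqr_ge0.
Qed.

Lemma sabs_gt0 t : 0 < sabs t. Proof. by rewrite sqrtr_gt0. Qed.

Lemma norm_le_sabs t : `|t| <= sabs t.
Proof. by rewrite -sqrtr_sqr ler_wsqrtr// lerDr sqr_ge0. Qed.

Lemma ssgn_le1 t : `|ssgn t| <= 1.
Proof.
rewrite normrM normfV (ger0_norm (ltW (sabs_gt0 t))) ler_pdivrMr ?sabs_gt0//.
by rewrite mul1r norm_le_sabs.
Qed.

Lemma dssgn_ge0 t : 0 <= dssgn t.
Proof. by rewrite divr_ge0 ?sqr_ge0// exprn_ge0// ltW// sabs_gt0. Qed.

Lemma dssgn_le t : dssgn t <= d^-1.
Proof.
rewrite /dssgn ler_pdivrMr ?exprn_gt0 ?sabs_gt0// -(ler_pM2l d0).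
rewrite mulVKf ?gt_eqF//.
by rewrite -exprS lerXn2r ?nnegrE ?sabs_ge ?ltW// sabs_gt0.
Qed.

Lemma is_derive_sabs t : is_derive t (1 : R) sabs (ssgn t).
Proof.
have Di : is_derive t (1 : R) (id : R -> R) 1 by exact: is_derive_id.
have Dc : is_derive t (1 : R) (cst (d ^+ 2)) 0 by exact: is_derive_cst.
have Dp : is_derive t (1 : R) (fun s => d ^+ 2 + s ^+ 2) (2 * t).
  have := is_deriveD Dc (is_deriveM Di Di).
  by rewrite /GRing.scale/= add0r mulr1 -mulr2n mulr_natl.
have := @is_derive1_comp _ _ (fun s => d ^+ 2 + s ^+ 2) _ _ _ (is_derive1_sqrt (p0 t)) Dp.
rewrite (_ : _ * (2 * t) = ssgn t)//.
rewrite /ssgn /sabs; field.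
by rewrite gt_eqF ?sqrtr_gt0.
Qed.

Lemma is_derive_ssgn t : is_derive t (1 : R) ssgn (dssgn t).
Proof.
have Di : is_derive t (1 : R) (id : R -> R) 1 by exact: is_derive_id.
have s0 : sabs t != 0 by rewrite gt_eqF// sabs_gt0.
have := is_deriveM Di (is_deriveV s0 (is_derive_sabs t)).
rewrite /GRing.scale/= mulr1; congr (is_derive _ _ _ _).
rewrite /dssgn /ssgn.
transitivity ((sabs t ^+ 2 - t ^+ 2) / sabs t ^+ 3); first by field.
by rewrite sabs_sqr addrK.
Qed.

Lemma continuous_is_derive (f df : R -> R) : (forall t : R, is_derive t 1 f (df t)) ->
  continuous f.
Proof.
move=> fd t; apply: differentiable_continuous; apply/derivable1_diffP.
by case: (fd t).
Qed.

Lemma continuous_dssgn : continuous dssgn.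
Proof.
have cs := continuous_is_derive is_derive_sabs.
move=> t.
have c3 : {for t, continuous (fun s => sabs s ^+ 3)}.
  exact: continuous_comp (cs t) (@exprn_continuous _ 3 _).
have s3 : sabs t ^+ 3 != 0 by rewrite expf_neq0// gt_eqF// sabs_gt0.
have cd : {for t, continuous (fun=> d ^+ 2 : R)} by exact: cst_continuous.
have cV := @continuousV _ _ (fun s => sabs s ^+ 3) t s3 c3.
have := @continuousM _ _ (fun=> d ^+ 2 : R) (fun s => (sabs s ^+ 3)^-1) t cd cV.
by [].
Qed.

Lemma is_derive_sabs0 t : is_derive t (1 : R) (fun s => sabs s - d) (ssgn t).
Proof.
have Dc : is_derive t (1 : R) (cst (- d)) 0 by exact: is_derive_cst.
by have := is_deriveD (is_derive_sabs t) Dc; rewrite addr0.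
Qed.

Lemma sabs00 : sabs 0 - d = 0.
Proof. by rewrite /sabs expr0n addr0 sqrtr_sqr gtr0_norm// subrr. Qed.

Lemma ssgn0 : ssgn 0 = 0. Proof. by rewrite /ssgn mul0r. Qed.

Lemma is_derive_ssgn_sqr t :
  is_derive t (1 : R) (fun s => ssgn s ^+ 2) (2 * ssgn t * dssgn t).
Proof.
have -> : 2 * ssgn t * dssgn t = ssgn t *: dssgn t + ssgn t *: dssgn t.
  by rewrite /GRing.scale/=; ring.
exact: (is_deriveM (is_derive_ssgn t) (is_derive_ssgn t)).
Qed.

Lemma continuous_ssgn_sqr : continuous (fun t => 2 * ssgn t * dssgn t).
Proof.
have cs := continuous_is_derive is_derive_ssgn.
move=> t; have c2 : {for t, continuous (fun=> 2 : R)} by exact: cst_continuous.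
exact: (continuousM (continuousM c2 (cs t)) (@continuous_dssgn t)).
Qed.

Lemma ssgn_sqr0 : ssgn 0 ^+ 2 = 0. Proof. by rewrite ssgn0 expr0n. Qed.

End smooth_sign.

Lemma near_eq_continuous_at (R : realType) (V : normedModType R) (f g : V -> R) (x : V) :
  (\forall y \near x, f y = g y) -> {for x, continuous f} -> {for x, continuous g}.
Proof.
move=> fg cf; rewrite /prop_for /continuous_at -(nbhs_singleton fg).
by apply: cvg_trans cf; exact: near_eq_cvg.
Qed.

Section local_times_supported.
Context {R : realType} {n : nat}.
Local Notation rV := 'rV[R]_n.
Local Notation mu := (@lebesgue_rV R n).
Local Notation e i := (delta_mx ord0 i : rV).
Variables (Omega K : set rV).
Hypotheses (cK : compact K) (KO : K `<=` Omega).

Lemma near_supported (w : rV -> R) (x : rV) : (forall y, ~ K y -> w y = 0) -> ~ K x ->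
  \forall y \near x, w y = 0.
Proof.
move=> w0 Kx; have oK : open (~` K) by apply: closed_openC; exact: compact_rV_closed.
have := open_nbhs_nbhs (conj oK Kx).
by apply: filterS => y /= /w0.
Qed.

Lemma continuous_mul_supported (a w : rV -> R) :
  (forall x, Omega x -> {for x, continuous a}) -> continuous w ->
  (forall x, ~ K x -> w x = 0) -> continuous (fun x => a x * w x).
Proof.
move=> ca cw w0.
suff H (x : rV) : {for x, continuous (fun x => a x * w x)} by exact: H.
have [Kx|Kx] := pselect (K x).
  by apply: continuousM; [exact/ca/KO|exact: cw].
have N := near_supported w0 Kx.
have C0 : {for x, continuous (cst (0 : R) : rV -> R)} by exact: cst_continuous.
apply: near_eq_continuous_at C0.
by apply: filterS N => y /= ->; rewrite mulr0.
Qed.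

Lemma is_derive_mul_supported (a da w dw : rV -> R) (v : rV) :
  (forall x, Omega x -> is_derive x v a (da x)) ->
  (forall x, is_derive x v w (dw x)) -> (forall x, ~ K x -> w x = 0) ->
  forall x, is_derive x v (fun x => a x * w x) (a x * dw x + w x * da x).
Proof.
move=> ad wd w0 x.
have [Kx|Kx] := pselect (K x).
  have Da := ad x (KO Kx).
  exact: (is_deriveM Da (wd x)).
have dw0 := is_derive_supported cK wd w0.
rewrite dw0// w0// mulr0 mul0r addr0.
have D0 : is_derive x v (cst (0 : R)) (0 : R) by exact: (is_derive_cst 0 x v).
apply: near_eq_is_derive D0.
by apply: filterS (near_supported w0 Kx) => y /= ->; rewrite mulr0.
Qed.

Lemma Rintegral_supported (f : rV -> R) : (forall x, ~ K x -> f x = 0) ->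
  \int[mu]_(x in Omega) f x = \int[mu]_x f x.
Proof.
move=> f0; rewrite Rintegral_mkcond; apply: eq_Rintegral => x _.
rewrite patchE; case: ifPn => // /negP xO; rewrite f0// => Kx.
by apply: xO; apply/mem_set; exact: KO.
Qed.

End local_times_supported.

Section C1c_theory.
Context {R : realType} {n : nat}.
Local Notation rV := 'rV[R]_n.
Local Notation mu := (@lebesgue_rV R n).
Local Notation e i := (delta_mx ord0 i : rV).
Variable Omega : set rV.
Hypothesis oO : open Omega.

Let mO : measurable Omega. Proof. exact: open_measurable_rV. Qed.

Lemma C1c_comp (g dg : R -> R) w dw : (forall t : R, is_derive t 1 g (dg t)) ->
  continuous dg -> g 0 = 0 -> C1c Omega w dw ->
  C1c Omega (fun x => g (w x)) (fun i x => dg (w x) * dw i x).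
Proof.
move=> gd cdg g0 [K [[cK KO w0] [cw cdw wd]]].
have cg := continuous_is_derive gd.
exists K; split; split => //.
- by move=> x Kx; rewrite w0.
- by move=> x; apply: (@continuous_comp _ _ _ w g); [exact: cw|exact: cg].
- move=> i x; apply: continuousM; last exact: cdw.
  by apply: (@continuous_comp _ _ _ w dg); [exact: cw|exact: cdg].
- by move=> i x; exact: is_derive_comp1.
Qed.

Lemma C1c_mul (a : rV -> R) (da : 'I_n -> rV -> R) w dw :
  (forall x, Omega x -> {for x, continuous a}) ->
  (forall i x, Omega x -> {for x, continuous (da i)}) ->
  (forall i x, Omega x -> is_derive x (e i) a (da i x)) ->
  C1c Omega w dw ->
  C1c Omega (fun x => a x * w x) (fun i x => a x * dw i x + w x * da i x).
Proof.
move=> ca cda ad [K [[cK KO w0] [cw cdw wd]]].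
have dw0 i := is_derive_supported cK (wd i) w0.
exists K; split; split => //.
- by move=> x /w0 ->; rewrite mulr0.
- exact: (continuous_mul_supported cK KO).
- move=> i x.
  have c1 := continuous_mul_supported cK KO ca (cdw i) (dw0 i).
  have c2 := continuous_mul_supported cK KO (cda i) cw w0.
  have -> : (fun x => a x * dw i x + w x * da i x) =
      (fun x => a x * dw i x) \+ (fun x => da i x * w x).
    by apply/funext => y /=; rewrite [w y * _]mulrC.
  exact: continuousD (c1 x) (c2 x).
- by move=> i; exact: (is_derive_mul_supported cK KO).
Qed.

(** Integration by parts for the product q w, of which only the second factor is
    known to be regular outside Omega. *)
Lemma C1c_divergence (q dq : rV -> R) w dw i :
  (forall x, Omega x -> {for x, continuous q}) ->
  (forall x, Omega x -> {for x, continuous dq}) ->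
  (forall x, Omega x -> is_derive x (e i) q (dq x)) ->
  C1c Omega w dw ->
  mu.-integrable Omega (EFin \o (fun x => q x * dw i x + w x * dq x)) /\
  \int[mu]_(x in Omega) (q x * dw i x + w x * dq x) = 0.
Proof.
move=> cq cdq qd [K [[cK KO w0] [cw cdw wd]]].
have dw0 := is_derive_supported cK (wd i) w0.
have c1 := continuous_mul_supported cK KO cq (cdw i) dw0.
have c2 := continuous_mul_supported cK KO cdq cw w0.
have cf : continuous (fun x => q x * dw i x + w x * dq x).
  have -> : (fun x => q x * dw i x + w x * dq x) =
      (fun x => q x * dw i x) \+ (fun x => dq x * w x).
    by apply/funext => y /=; rewrite [w y * _]mulrC.
  by move=> x; exact: continuousD (c1 x) (c2 x).
have f0 x : ~ K x -> q x * dw i x + w x * dq x = 0.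
  by move=> Kx; rewrite w0// dw0// mulr0 mul0r addr0.
split.
  have := supported_integrable cK cf f0.
  exact: (integrableS measurableT mO).
rewrite (Rintegral_supported KO f0).
apply: (integral_is_derive_supported cK (f := fun x => q x * w x) (e := e i)) => //.
- exact: (continuous_mul_supported cK KO).
- exact: (is_derive_mul_supported cK KO).
- by move=> x /w0 ->; rewrite mulr0.
Qed.

Lemma C1c_L2 w dw : bounded_set Omega -> C1c Omega w dw ->
  L2 Omega w /\ forall i, L2 Omega (dw i).
Proof.
move=> bO [K [[cK KO w0] [cw cdw wd]]].
split; first exact: (L2_supported oO bO cK).
by move=> i; apply: (L2_supported oO bO cK) => //; exact: is_derive_supported (wd i) w0.
Qed.

End C1c_theory.

(** * Testing a superharmonic function against an eigenfunction *)

Ltac nng := repeat first [assumption | exact: sqr_ge0 | exact: ler0n | exact: ler01 |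
  apply: ltW; assumption | apply: divr_ge0 | apply: mulr_ge0 | apply: addr_ge0].

Lemma Rintegral_sum d (T : measurableType d) (R : realType)
    (mu : {measure set T -> \bar R}) (D : set T) I (s : seq I) (f : I -> T -> R) :
  measurable D -> (forall i, mu.-integrable D (EFin \o f i)) ->
  \int[mu]_(x in D) (\sum_(i <- s) f i x) = \sum_(i <- s) \int[mu]_(x in D) f i x.
Proof.
move=> mD fi; elim: s => [|i s IH].
  rewrite big_nil; under eq_Rintegral do rewrite big_nil.
  by rewrite Rintegral_cst// mul0r.
rewrite big_cons -IH -RintegralD//; last exact: rintegrable_sum.
by apply: eq_Rintegral => x _; rewrite big_cons.
Qed.

(** The pointwise heart of the argument, in one direction: p, g and q stand for
    the partial derivatives of the test function psi, of phi and of v, and t, dt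
    for ssgn psi, dssgn psi. If p = g, the two cross terms g t q and q t p
    cancel and g v dt p is nonnegative; the error p - g is absorbed by the
    square (t q)^2, which the last term on the right supplies with weight s.
    The coefficient b of g^2 vanishes as s tends to 0, whereas a may be large
    because p - g will be small. *)
Lemma gradient_young (R : realType) (s C e v t dt p q g D b a : R) :
  0 < s -> 0 <= v -> v <= C -> 0 <= dt -> dt <= e ->
  D = C * e -> b = s * (4 * D ^+ 2 + D) -> a = (1 + D) / (2 * s) + b ->
  - (a * (p - g) ^+ 2 + b * g ^+ 2) <=
  g * (v * (dt * p) + t * q) - q * (t * p) -
  s * (q * ((C - v) * (2 * t * dt * p) + t ^+ 2 * - q)).
Proof.
move=> s0 v0 vC dt0 dte DE bE aE.
set A := v * dt; set B := (C - v) * dt; set X := t * q; set r := g - p.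
have A0 : 0 <= A by rewrite mulr_ge0.
have B0 : 0 <= B by rewrite mulr_ge0// subr_ge0.
have C0 : 0 <= C by exact: le_trans vC.
have e0 : 0 <= e by exact: le_trans dte.
have AD : A <= D by rewrite DE ler_pM.
have BD : B <= D by rewrite DE ler_pM ?subr_ge0// lerBlDr lerDl.
have D0 : 0 <= D by rewrite DE; nng.
have B2 : B ^+ 2 <= D ^+ 2 by rewrite lerXn2r.
pose w := (2 * s)^-1.
have w0 : 0 <= w by rewrite invr_ge0 mulr_ge0// ltW.
have ws : w * s = 2^-1 by rewrite /w; field; rewrite gt_eqF.
have Ea : a = w + D * w + b by rewrite aE /w; field; rewrite gt_eqF.
have H1 : 0 <= w * (s * X + r) ^+ 2 by nng.
have H2 : 0 <= s / 2 * (X - 2 * B * p) ^+ 2 by nng.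
have H3 : 0 <= A * (w * (s * p + r) ^+ 2) by nng.
have H4 : 0 <= A * p ^+ 2 by nng.
have H5 : A * (s / 2 * p ^+ 2 + w * r ^+ 2) <= D * (s / 2 * p ^+ 2 + w * r ^+ 2).
  by apply: ler_wpM2r => //; nng.
have H6 : 2 * s * B ^+ 2 * p ^+ 2 <= 2 * s * D ^+ 2 * p ^+ 2.
  by apply: ler_wpM2r; [nng|apply: ler_wpM2l => //; nng].
have H7 : p ^+ 2 <= 2 * g ^+ 2 + 2 * r ^+ 2.
  have := sqr_ge0 (g + r); rewrite /r; nra.
have H8 : (2 * s * D ^+ 2 + D * (s / 2)) * p ^+ 2 <=
    (2 * s * D ^+ 2 + D * (s / 2)) * (2 * g ^+ 2 + 2 * r ^+ 2).
  by apply: ler_wpM2l => //; nng.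
have E1 : w * (s * X + r) ^+ 2 = s / 2 * X ^+ 2 + X * r + w * r ^+ 2.
  transitivity ((w * s) * s * X ^+ 2 + 2 * (w * s) * X * r + w * r ^+ 2); first by ring.
  by rewrite ws; field.
have E3 : w * (s * p + r) ^+ 2 = s / 2 * p ^+ 2 + p * r + w * r ^+ 2.
  transitivity ((w * s) * s * p ^+ 2 + 2 * (w * s) * p * r + w * r ^+ 2); first by ring.
  by rewrite ws; field.
rewrite -subr_ge0.
suff -> : g * (v * (dt * p) + t * q) - q * (t * p) -
    s * (q * ((C - v) * (2 * t * dt * p) + t ^+ 2 * - q)) -
    - (a * (p - g) ^+ 2 + b * g ^+ 2) =
  w * (s * X + r) ^+ 2 + s / 2 * (X - 2 * B * p) ^+ 2 +
  A * (w * (s * p + r) ^+ 2) + A * p ^+ 2 +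
  (D * (s / 2 * p ^+ 2 + w * r ^+ 2) - A * (s / 2 * p ^+ 2 + w * r ^+ 2)) +
  (2 * s * D ^+ 2 * p ^+ 2 - 2 * s * B ^+ 2 * p ^+ 2) +
  ((2 * s * D ^+ 2 + D * (s / 2)) * (2 * g ^+ 2 + 2 * r ^+ 2) -
   (2 * s * D ^+ 2 + D * (s / 2)) * p ^+ 2) by lra.
rewrite E1 E3 Ea bE /X /A /B /r; field.
by [].
Qed.

Section superharmonic.
Context {R : realType} {n : nat}.
Local Notation rV := 'rV[R]_n.
Local Notation mu := (@lebesgue_rV R n).
Local Notation e i := (delta_mx ord0 i : rV).
Variable Omega : set rV.
Hypotheses (oO : open Omega) (bO : bounded_set Omega).
Variables (l : R) (phi : rV -> R).
Hypotheses (l0 : 0 <= l) (hphi : dirichlet_eigenpair Omega l phi)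
  (iphi : \int[mu]_(x in Omega) phi x = 1).
Variables (v h : rV -> R) (dv d2v : 'I_n -> rV -> R) (C H : R).
Hypotheses
  (cv : forall x, Omega x -> {for x, continuous v})
  (cdv : forall i x, Omega x -> {for x, continuous (dv i)})
  (cd2v : forall i x, Omega x -> {for x, continuous (d2v i)})
  (vd : forall i x, Omega x -> is_derive x (e i) v (dv i x))
  (ddv : forall i x, Omega x -> is_derive x (e i) (dv i) (d2v i x))
  (v0 : forall x, Omega x -> 0 <= v x) (vC : forall x, Omega x -> v x <= C)
  (mh : measurable_fun Omega h)
  (h0 : forall x, Omega x -> 0 <= h x) (hH : forall x, Omega x -> h x <= H)
  (hv : forall x, Omega x -> h x <= - \sum_i d2v i x).

Let mO : measurable Omega. Proof. exact: open_measurable_rV. Qed.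

Let L2h : L2 Omega h.
Proof.
apply: (L2_bounded oO bO (M := H)) => // x Ox.
by rewrite ger0_norm ?h0// hH.
Qed.

Let L2v : L2 Omega v.
Proof.
apply: (L2_bounded oO bO (M := C)); first exact: open_continuous_measurable_rV.
by move=> x Ox; rewrite ger0_norm ?v0// vC.
Qed.

(** Formally, multiply - Delta v >= h by phi and integrate by parts twice. But
    phi is only a weak solution, and the gradient of v is not controlled near
    the boundary. Let psi be a test function close to phi, and
    t = ssgn psi. Three identities hold:
    - the integral of (- Delta v) (sabs psi - d) is that of t dv . dpsi;
    - the integral of (- Delta v) (C - v) t^2 is that of dv . d((C - v) t^2),
      which controls t^2 |dv|^2 by |dpsi|^2 (a Caccioppoli estimate);
    - the integral of G . d(v t) is l times that of phi v t, by the weak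
      equation, since v t is of class C^1 with compact support.
    Their combination Z = third - first - s second integrates to zero, and Z is
    bounded below by LB, the expected integrand up to errors. Then psi tends to
    phi, s to 0 and d to 0; here one d governs the three limits. *)
Lemma superharmonic_test :
  \int[mu]_(x in Omega) (h x * phi x) <= l * \int[mu]_(x in Omega) (v x * `|phi x|).
Proof.
have [G HG Heq] := hphi.
have [L2phi L2G] := H10_L2 oO bO HG.
have Hk := exists_kernel_H10 oO bO HG iphi.
have L2aphi := L2_norm oO L2phi.
have hphii := L2M oO L2h L2phi.
have vphii := L2M oO L2v L2aphi.
have hi := L2_int oO bO L2h.
have [_ h2i] := L2h.
pose Kc : R := \int[mu]_(x in Omega) h x + (\int[mu]_(x in Omega) (h x ^+ 2)) / 2 + 1 +
  \sum_i \int[mu]_(x in Omega) (G i x ^+ 2).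
have Ih0 : 0 <= \int[mu]_(x in Omega) h x by exact: Rintegral_ge0.
have Ih20 : 0 <= \int[mu]_(x in Omega) (h x ^+ 2).
  by apply: Rintegral_ge0 => x _; exact: sqr_ge0.
have IG0 i : 0 <= \int[mu]_(x in Omega) (G i x ^+ 2).
  by apply: Rintegral_ge0 => x _; exact: sqr_ge0.
have SG0 : 0 <= \sum_i \int[mu]_(x in Omega) (G i x ^+ 2) by exact: sumr_ge0.
have Kc0 : 0 < Kc.
  by rewrite /Kc ltr_pwDl// ltr_pwDr// addr_ge0// divr_ge0.
suff main (d : R) : 0 < d -> \int[mu]_(x in Omega) (h x * phi x) -
    l * \int[mu]_(x in Omega) (v x * `|phi x|) <= d * Kc.
  rewrite -subr_le0; apply/ler_addgt0Pl => eps eps0; rewrite addr0.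
  by have := main (eps / Kc) (divr_gt0 eps0 Kc0); rewrite divfK ?gt_eqF.
move=> d0.
have C0 : 0 <= C.
  have [[x Ox]|nO] := pselect (exists x, Omega x).
    exact: le_trans (v0 Ox) (vC Ox).
  have O0 : Omega = set0 by apply/seteqP; split => x // Ox; apply: nO; exists x.
  by move: iphi; rewrite O0 Rintegral_set0 => /esym/eqP; rewrite oner_eq0.
pose D := C * d^-1.
have D0 : 0 <= D by rewrite mulr_ge0// invr_ge0 ltW.
have D1 : 0 < 4 * D ^+ 2 + D + 1 by rewrite ltr_wpDl//; nng.
(* with this s the coefficient b of |G|^2 is at most d *)
pose s := d / (4 * D ^+ 2 + D + 1).
have s0 : 0 < s by rewrite divr_gt0.
have sd : s <= d.
  by rewrite ler_pdivrMr//; apply: ler_peMr; [exact: ltW|rewrite lerDr; nng].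
pose b := s * (4 * D ^+ 2 + D).
have b0 : 0 <= b by rewrite /b; nng.
have bd : b <= d.
  rewrite /b /s mulrAC ler_pdivrMr// ler_pM2l// lerDl//.
pose a := (1 + D) / (2 * s) + b.
have a0 : 0 <= a by rewrite /a; nng.
have s20 : 0 < (2 * s)^-1 by rewrite invr_gt0 mulr_gt0.
have na0 : 0 < (2 * s)^-1 + n%:R * a by rewrite ltr_pwDl// mulr_ge0.
(* with this eps the errors due to psi - phi add up to d *)
pose eps := d / ((2 * s)^-1 + n%:R * a).
have eps0 : 0 < eps by rewrite divr_gt0.
have [psi [tpsi [L2d dle] Hi]] := H10_close eps0 HG.
have Cpsi := test_function_C1c tpsi.
pose w1 x := sabs d (psi x) - d.
pose dw1 i x := ssgn d (psi x) * partial i psi x.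
pose w2 x := (C - v x) * ssgn d (psi x) ^+ 2.
pose dw2 i x := (C - v x) * (2 * ssgn d (psi x) * dssgn d (psi x) * partial i psi x) +
  ssgn d (psi x) ^+ 2 * - dv i x.
pose w3 x := v x * ssgn d (psi x).
pose dw3 i x := v x * (dssgn d (psi x) * partial i psi x) + ssgn d (psi x) * dv i x.
(* w1, w2, w3 are the test functions of the three identities *)
have C1 : C1c Omega w1 dw1.
  exact: C1c_comp (is_derive_sabs0 d0)
    (continuous_is_derive (is_derive_ssgn d0)) (sabs00 d0) Cpsi.
have Ct := C1c_comp (is_derive_ssgn d0) (continuous_dssgn d0) (ssgn0 d) Cpsi.
have Ctt := C1c_comp (is_derive_ssgn_sqr d0) (continuous_ssgn_sqr d0)
  (ssgn_sqr0 d) Cpsi.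
have C3 : C1c Omega w3 dw3 by exact: C1c_mul cv cdv vd Ct.
have C2 : C1c Omega w2 dw2.
  apply: (@C1c_mul _ _ _ (fun x => C - v x) (fun i x => - dv i x)) Ctt.
  - move=> x Ox; have cC : {for x, continuous (fun=> C)} by exact: cst_continuous.
    exact: (continuousB cC (@cv x Ox)).
  - by move=> i x Ox; exact: (continuousN (@cdv i x Ox)).
  - move=> i x Ox; have Dc := is_derive_cst C x (e i).
    by have := is_deriveB Dc (@vd i x Ox); rewrite sub0r.
have A1 i := C1c_divergence oO (@cdv i) (@cd2v i) (@ddv i) C1.
have A2 i := C1c_divergence oO (@cdv i) (@cd2v i) (@ddv i) C2.
have E3 := Heq _ _ (C1c_H10_grad oO bO Hk C3).
have [L2w3 L2dw3] := C1c_L2 oO bO C3.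
have G3i i := L2M oO (L2G i) (L2dw3 i).
have SG3i := rintegrable_sum mO (index_enum 'I_n) G3i.
have p3i := L2M oO L2phi L2w3.
have lp3i := rintegrableZ mO l p3i.
have SA1i := rintegrable_sum mO (index_enum 'I_n) (fun i => (A1 i).1).
have SA2i := rintegrable_sum mO (index_enum 'I_n) (fun i => (A2 i).1).
have sSA2i := rintegrableZ mO s SA2i.
pose Z x := (\sum_i G i x * dw3 i x) - l * (phi x * w3 x) -
  (\sum_i (dv i x * dw1 i x + w1 x * d2v i x)) -
  s * (\sum_i (dv i x * dw2 i x + w2 x * d2v i x)).
have B1 := rintegrableB mO SG3i lp3i.
have B2 := rintegrableB mO B1 SA1i.
have Zi := rintegrableB mO B2 sSA2i.
have Z0 : \int[mu]_(x in Omega) Z x = 0.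
  rewrite /Z RintegralB// RintegralB// RintegralB// !RintegralZl// E3.
  rewrite (Rintegral_sum _ mO (fun i => (A1 i).1)).
  rewrite (Rintegral_sum _ mO (fun i => (A2 i).1)).
  rewrite big1 => [|i _]; last exact: (A1 i).2.
  rewrite big1 => [|i _]; last exact: (A2 i).2.
  by rewrite subrr mulr0 !subr0.
pose LB x := h x * phi x - (s / 2 * h x ^+ 2 + (2 * s)^-1 * (psi x - phi x) ^+ 2) -
  d * h x - l * (v x * `|phi x|) -
  \sum_i (a * (partial i psi x - G i x) ^+ 2 + b * G i x ^+ 2).
have I1 := rintegrableD mO (rintegrableZ mO (s / 2) h2i)
  (rintegrableZ mO (2 * s)^-1 L2d.2).
have I2 := rintegrableB mO hphii I1.
have I3 := rintegrableB mO I2 (rintegrableZ mO d hi).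
have I4 := rintegrableB mO I3 (rintegrableZ mO l vphii).
have I5 i := rintegrableD mO (rintegrableZ mO a (Hi i).1.2) (rintegrableZ mO b (L2G i).2).
have I6 := rintegrable_sum mO (index_enum 'I_n) I5.
have LBi := rintegrableB mO I4 I6.
have LBZ x : Omega x -> LB x <= Z x.
  move=> Ox.
  have t1 := ssgn_le1 d0 (psi x).
  have dt0 := dssgn_ge0 d0 (psi x).
  have dte := dssgn_le d0 (psi x).
  pose S := \sum_i d2v i x.
  have ZE : Z x = \sum_i (G i x * dw3 i x - dv i x * dw1 i x - s * (dv i x * dw2 i x)) +
      (w1 x + s * w2 x) * - S - l * (phi x * w3 x).
    rewrite /Z !sumrB -mulr_sumr !big_split /= -!mulr_sumr -/S; ring.
  have ZS : - \sum_i (a * (partial i psi x - G i x) ^+ 2 + b * G i x ^+ 2) <=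
      \sum_i (G i x * dw3 i x - dv i x * dw1 i x - s * (dv i x * dw2 i x)).
    rewrite -sumrN; apply: ler_sum => i _.
    have := @gradient_young R s C d^-1 (v x) (ssgn d (psi x)) (dssgn d (psi x))
      (partial i psi x) (dv i x) (G i x) D b a
      s0 (v0 Ox) (vC Ox) dt0 dte erefl erefl erefl.
    by [].
  have w10 : 0 <= w1 x by rewrite subr_ge0; exact: sabs_ge.
  have w20 : 0 <= w2 x by rewrite mulr_ge0 ?subr_ge0 ?vC// sqr_ge0.
  have hS := hv Ox; rewrite -/S in hS; have h0x := h0 Ox.
  have ws0 : 0 <= w1 x + s * w2 x by nng.
  have K1 : (w1 x) * h x <= (w1 x + s * w2 x) * - S.
    apply: (@le_trans _ _ ((w1 x + s * w2 x) * h x)); last exact: ler_wpM2l.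
    by apply: ler_wpM2r => //; rewrite lerDl; nng.
  have K2 : (phi x - `|psi x - phi x| - d) * h x <= w1 x * h x.
    apply: ler_wpM2r => //; rewrite /w1 lerD2r.
    apply: le_trans (norm_le_sabs d (psi x)); rewrite lerBlDr.
    apply: le_trans (ler_norm _) _.
    by rewrite -{1}(subKr (psi x) (phi x)); exact: ler_normB.
  have K3 : h x * `|psi x - phi x| <=
      s / 2 * h x ^+ 2 + (2 * s)^-1 * (psi x - phi x) ^+ 2.
    rewrite -subr_ge0 -(real_normK (num_real (psi x - phi x))).
    rewrite (_ : _ - _ = (2 * s)^-1 * (s * h x - `|psi x - phi x|) ^+ 2).
      by apply: mulr_ge0; [exact: ltW|exact: sqr_ge0].
    by field; rewrite gt_eqF.
  have K4 : l * (phi x * w3 x) <= l * (v x * `|phi x|).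
    apply: ler_wpM2l => //; rewrite /w3 mulrCA; apply: ler_wpM2l; first exact: v0.
    by rewrite (le_trans (ler_norm _))// normrM ler_piMr.
  rewrite ZE /LB; lra.
have := le_Rintegral mO LBi Zi LBZ; rewrite Z0.
rewrite /LB RintegralB// RintegralB//; last exact: rintegrableZ.
rewrite RintegralB//; last exact: rintegrableZ.
rewrite RintegralB// RintegralD//; [|exact: rintegrableZ..|exact: rintegrableZ L2d.2].
rewrite !RintegralZl//; last exact: L2d.2.
rewrite (Rintegral_sum _ mO I5) => main.
have HS : \sum_i \int[mu]_(x in Omega)
      (a * (partial i psi x - G i x) ^+ 2 + b * G i x ^+ 2) <=
    n%:R * (a * eps) + d * \sum_i \int[mu]_(x in Omega) (G i x ^+ 2).
  rewrite (_ : n%:R * (a * eps) = \sum_(i < n) (a * eps)); last first.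
    by rewrite sumr_const card_ord mulr_natl.
  rewrite mulr_sumr -big_split; apply: ler_sum => i _ /=.
  rewrite RintegralD//; last exact: rintegrableZ (L2G i).2.
    rewrite !RintegralZl//; [|exact: (L2G i).2|exact: (Hi i).1.2].
    apply: lerD; first by apply: ler_wpM2l => //; exact: (Hi i).2.
    exact: ler_wpM2r.
  exact: rintegrableZ (Hi i).1.2.
have Heps : (2 * s)^-1 * eps + n%:R * (a * eps) = d.
  by rewrite mulrA -mulrDl /eps mulrC divfK// gt_eqF.
have Hd : (2 * s)^-1 * \int[mu]_(x in Omega) (psi x - phi x) ^+ 2 <= (2 * s)^-1 * eps.
  by apply: ler_wpM2l => //; exact: ltW.
have Hs : s / 2 * \int[mu]_(x in Omega) h x ^+ 2 <=
    d / 2 * \int[mu]_(x in Omega) h x ^+ 2.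
  by apply: ler_wpM2r => //; apply: ler_wpM2r.
rewrite /Kc; lra.
Qed.

End superharmonic.

(** * Nonlinearities *)

Section nonlinearity_theory.
Context {R : realType}.
Implicit Types (a : \bar R) (F : R -> R).

Lemma real_between (t : R) a : (t%:E < a)%E -> exists2 m, t < m & (m%:E < a)%E.
Proof.
case: a => [r||//].
- rewrite lte_fin => tr; exists ((t + r) / 2); rewrite ?lte_fin; lra.
- by exists (t + 1); [rewrite ltrDl|exact: ltry].
Qed.

Lemma smooth_withinP a F : smooth_within (nl_domain a) F ->
  exists G : nat -> R -> R, (forall t, nl_domain a t -> G 0%N t = F t) /\
  forall k x eps, nl_domain a x -> 0 < eps -> exists2 d : R, 0 < d &
    forall y, nl_domain a y -> y != x -> `|y - x| < d ->
    `|(G k y - G k x) / (y - x) - G k.+1 x| < eps.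
Proof.
move=> [G [GF GD]]; exists G; split=> [t Dt|k x eps Dx eps0].
  by apply: GF; exact/mem_set.
have := GD k x Dx; move/cvgrPdist_lt => /(_ _ eps0).
rewrite near_withinE near_withinE -nbhs_ballE => -[d /= d0 Hd].
exists d => // y Dy yx xy; rewrite distrC; apply: Hd => //.
by rewrite -ball_normE /ball_ /= distrC.
Qed.

Lemma nonlinearity_ge1 a F t : nonlinearity a F -> nl_domain a t -> 1 <= F t.
Proof.
move=> [_ homF _ F0] Dt; rewrite -F0; apply: homF; rewrite ?inE//; last by case: Dt.
by split => //; case: Dt => t0; apply: le_lt_trans; rewrite lee_fin.
Qed.

(** Below 0, F is continued by its tangent. Solutions may vanish inside Omega,
    and the chain rule at such points needs a two-sided derivative; the
    extension is of class C^1 and positive on a neighbourhood of [0, a). *)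
Lemma nonlinearity_extension a F : nonlinearity a F -> (0 < a)%E ->
  exists Fe F1 : R -> R, [/\ forall t, nl_domain a t -> Fe t = F t,
    exists2 eta, 0 < eta & forall t, - eta < t -> (t%:E < a)%E -> 0 < Fe t,
    forall t, (t%:E < a)%E -> is_derive t (1 : R) Fe (F1 t),
    forall t, (t%:E < a)%E -> {for t, continuous F1}
    & forall t, (t%:E < a)%E -> 0 <= F1 t].
Proof.
move=> nF a0; have [/smooth_withinP[G [G0 GD]] homF _ F0] := nF.
have D0 : nl_domain a 0 by split.
have FG t : nl_domain a t -> F t = G 0%N t by move=> /G0.
have G1_ge0 t : nl_domain a t -> 0 <= G 1%N t.
  move=> Dt; rewrite leNgt; apply/negP => Gt.
  have [|d d0 Hd] := GD 0%N t (- G 1%N t) Dt; first by rewrite oppr_gt0.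
  have [m tm ma] := real_between Dt.2.
  pose y := Num.min m (t + d / 2).
  have ty : t < y by rewrite lt_min tm/= ltrDl divr_gt0.
  have Dy : nl_domain a y.
    split; first by rewrite ltW// (le_lt_trans _ ty)//; case: Dt.
    by apply: le_lt_trans ma; rewrite lee_fin ge_min lexx.
  have yt : 0 < y - t by rewrite subr_gt0.
  have := Hd y Dy; rewrite gt_eqF// gtr0_norm// => /(_ isT).
  have -> : y - t < d.
    rewrite ltrBlDl (@le_lt_trans _ _ (t + d / 2))//; first by rewrite ge_min lexx orbT.
    by rewrite ltrD2l ltr_pdivrMr// ltr_pMr// ltr1n.
  move=> /(_ isT); rewrite ltr_norml => /andP[_]; rewrite ltrBlDr addNr.
  rewrite pmulr_llt0 ?invr_gt0// subr_lt0 !G0// ltNge => /negP; apply.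
  by apply: homF; rewrite ?inE//; exact: ltW.
pose Fe t := if 0 <= t then G 0%N t else 1 + G 1%N 0 * t.
pose F1 t := if 0 <= t then G 1%N t else G 1%N 0.
have FeN t : t <= 0 -> Fe t = 1 + G 1%N 0 * t.
  rewrite /Fe; case: (leP 0 t) => // t0 t0'.
  have -> : t = 0 by apply/eqP; rewrite eq_le t0 t0'.
  by rewrite mulr0 addr0 G0.
have F1N t : t <= 0 -> F1 t = G 1%N 0.
  rewrite /F1; case: (leP 0 t) => // t0 t0'.
  by have -> : t = 0 by apply/eqP; rewrite eq_le t0 t0'.
(* Only at t = 0 do both formulas defining Fe occur in every neighbourhood;
   comparing t with each nearby y separately keeps one formula at a time. *)
have near_t t : (t%:E < a)%E -> exists2 r, 0 < r & forall y, `|y - t| < r ->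
    (nl_domain a t /\ nl_domain a y) \/ (t <= 0 /\ y <= 0).
  move=> ta; have [m tm ma] := real_between ta.
  have [t0|t0|t0] := ltgtP t 0.
  - exists (- t); first by rewrite oppr_gt0.
    move=> y; rewrite ltr_norml => /andP[_]; rewrite ltrBlDr addNr => y0.
    by right; rewrite !ltW.
  - exists (Num.min t (m - t)); first by rewrite lt_min t0 subr_gt0.
    move=> y; rewrite lt_min !ltr_norml => /andP[/andP[y1 _] /andP[_ y2]].
    left; split; split => //; [exact: ltW|lra|].
    by apply: lt_trans ma; rewrite lte_fin; lra.
  - exists m; first by rewrite -t0.
    move=> y; rewrite t0 subr0 ltr_norml => /andP[_ ym].
    have [y0|y0] := leP 0 y; last by right; rewrite ltW.
    left; split => //; split => //.
    by apply: lt_trans ma; rewrite lte_fin.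
exists Fe, F1; split.
- by move=> t Dt; rewrite /Fe Dt.1 G0.
- exists (G 1%N 0 + 1)^-1; first by rewrite invr_gt0 ltr_wpDl// G1_ge0.
  move=> t et ta; have [t0|t0] := leP 0 t.
    have Dt : nl_domain a t by split.
    rewrite /Fe t0 -FG// (lt_le_trans ltr01)//.
    exact: nonlinearity_ge1 nF Dt.
  rewrite FeN ?ltW//.
  have g0 : 0 < G 1%N 0 + 1 by rewrite ltr_wpDl// G1_ge0.
  have : (G 1%N 0 + 1) * - t < 1.
    by rewrite mulrC -ltr_pdivlMr// div1r ltrNl.
  rewrite mulrDl mul1r mulrN => H; lra.
- move=> t ta; apply: is_derive_epsilon => eps eps0.
  have [r r0 Hr] := near_t t ta.
  have [Dt|nDt] := pselect (nl_domain a t).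
    have [d d0 Hd] := GD 0%N t eps Dt eps0.
    exists (Num.min d r) => [|h h0]; first by rewrite lt_min d0.
    rewrite lt_min => /andP[hd hr].
    have [|[_ Dy]|[t0 y0]] := Hr (h *: 1 + t); first by rewrite addrK [_ *: _]mulr1.
      have := Hd _ Dy; rewrite addrK [_ *: _]mulr1 => Hd'.
      rewrite /Fe /F1 Dt.1; move: (Dy.1); rewrite [_ *: _]mulr1 => ->.
      by rewrite mulrC; apply: Hd' => //; rewrite -subr_eq0 addrK.
    move: y0; rewrite [_ *: _]mulr1 => y0.
    rewrite !FeN// F1N// (_ : _ - _ = 0) ?normr0//.
    by field.
  exists r => // h h0 hr.
  have [|[//]|[t0 y0]] := Hr (h *: 1 + t); first by rewrite addrK [_ *: _]mulr1.
  move: y0; rewrite [_ *: _]mulr1 => y0.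
  rewrite !FeN// F1N// (_ : _ - _ = 0) ?normr0//.
  by field.
- move=> t ta; apply: epsilon_continuous_at => eps eps0; have [r r0 Hr] := near_t t ta.
  have [Dt|nDt] := pselect (nl_domain a t); last first.
    exists r => // y; rewrite distrC => /Hr[[//]|[t0 y0]].
    by rewrite !F1N// subrr normr0.
  have [d d0 Hd] := GD 1%N t 1 Dt ltr01.
  pose c := `|G 2%N t| + 1.
  have c0 : 0 < c by rewrite ltr_wpDl.
  exists (Num.min (Num.min d r) (eps / c)).
    by rewrite !lt_min d0 r0 divr_gt0.
  move=> y; rewrite distrC !lt_min => /andP[/andP[yd yr] yeps].
  case: (Hr y yr) => [[_ Dy]|[t0 y0]]; last by rewrite !F1N// subrr normr0.
  have [->|yt] := eqVneq y t; first by rewrite subrr normr0.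
  rewrite /F1 Dt.1 Dy.1 distrC.
  have yt0 : y - t != 0 by rewrite subr_eq0.
  have -> : G 1%N y - G 1%N t = (G 1%N y - G 1%N t) / (y - t) * (y - t) by rewrite divfK.
  rewrite normrM.
  have Hq : `|(G 1%N y - G 1%N t) / (y - t)| <= c.
    rewrite -(subrK (G 2%N t) (_ / _)) (le_trans (ler_normD _ _))// /c addrC lerD2l ltW//.
    exact: Hd.
  apply: (@le_lt_trans _ _ (c * `|y - t|)); first exact: ler_wpM2r.
  by rewrite mulrC -ltr_pdivlMr.
- move=> t ta; rewrite /F1; case: (leP 0 t) => t0; last exact: G1_ge0.
  by apply: G1_ge0.
Qed.

End nonlinearity_theory.

(** * The primitive of 1 / F *)

Section reciprocal_primitive.
Context {R : realType}.
Local Notation mu := (@lebesgue_measure R).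
Implicit Types (a : \bar R) (F : R -> R).

Lemma open_nl_interior a : (0 < a)%E -> open (nl_interior a : set R).
Proof.
case: a => [r||//] _.
- rewrite (_ : nl_interior _ = `]0, r[%classic); first exact: interval_open.
  apply/seteqP; split => t; rewrite /nl_interior /= in_itv/= lte_fin.
    by case=> -> ->.
  by move/andP.
- rewrite (_ : nl_interior _ = `]0, +oo[%classic); first exact: interval_open.
  apply/seteqP; split => t /=; rewrite in_itv/= andbT; first by case.
  by move=> t0; split => //; exact: ltry.
Qed.

(** g is the primitive of 1 / F vanishing at 0. It is computed from a base point
    c slightly below 0, where the extension of F is still positive, so that
    the fundamental theorem of calculus applies at 0 as well. *)
Lemma primitive_reciprocal a F (M : R) : nonlinearity a F -> 0 <= M -> (M%:E < a)%E ->
  exists g gam dgam : R -> R, forall t, 0 <= t -> t <= M ->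
  [/\ is_derive t (1 : R) g (gam t), is_derive t (1 : R) gam (dgam t),
      {for t, continuous dgam}, gam t = (F t)^-1 /\ dgam t <= 0
    & 0 <= g t /\ ((g t)%:E <= C_F a F)%E].
Proof.
move=> nF M0 Ma.
have a0 : (0 < a)%E by apply: le_lt_trans Ma; rewrite lee_fin.
have [Fe [F1 [FeF [eta eta0 Fe0] FeD cF1 F1_ge0]]] := nonlinearity_extension nF a0.
have [m Mm ma] := real_between Ma.
pose c := - (eta / 2).
have c0 : c < 0 by rewrite oppr_lt0 divr_gt0.
have ec t : c <= t -> - eta < t.
  by move=> ct; apply: lt_le_trans ct; rewrite /c; lra.
have lta t : t <= m -> (t%:E < a)%E.
  by move=> tm; apply: le_lt_trans ma; rewrite lee_fin.
pose gam t := (Fe t)^-1.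
pose dgam t := - (Fe t) ^- 2 * F1 t.
have gamD t : - eta < t -> (t%:E < a)%E -> is_derive t (1 : R) gam (dgam t).
  move=> et ta; have Fn0 : Fe t != 0 by rewrite gt_eqF// Fe0.
  have Ft := FeD t ta.
  exact: (is_deriveV Fn0 Ft).
have cgam t : - eta < t -> (t%:E < a)%E -> {for t, continuous gam}.
  move=> et ta; apply: differentiable_continuous; apply/derivable1_diffP.
  by case: (gamD t et ta).
have cFe t : (t%:E < a)%E -> {for t, continuous Fe}.
  move=> ta; apply: differentiable_continuous; apply/derivable1_diffP.
  by case: (FeD t ta).
have cdgam t : - eta < t -> (t%:E < a)%E -> {for t, continuous dgam}.
  move=> et ta.
  have Fn0 : Fe t ^+ 2 != 0 by rewrite expf_neq0// gt_eqF// Fe0.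
  have c2 : {for t, continuous (fun s => Fe s ^+ 2)}.
    exact: continuous_comp (cFe t ta) (@exprn_continuous _ 2 _).
  have c3 := @continuousV _ _ (fun s => Fe s ^+ 2) t Fn0 c2.
  have c4 := @continuousN _ _ _ (fun s => (Fe s ^+ 2)^-1) t c3.
  exact: (@continuousM _ _ (fun s => - (Fe s ^+ 2)^-1) F1 t c4 (cF1 t ta)).
have gami : mu.-integrable `[c, m] (EFin \o gam).
  apply: continuous_compact_integrable; first exact: segment_compact.
  apply: continuous_in_subspaceT => t /set_mem /=; rewrite in_itv/= => /andP[ct tm].
  by apply: cgam; [exact: ec|exact: lta].
pose P x := \int[mu]_(t in `[c, x]) gam t.
have PD t : 0 <= t -> t <= M -> is_derive t (1 : R) P (gam t).
  move=> t0 tM.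
  have tm : t < m by exact: le_lt_trans Mm.
  have ct : c < t by exact: lt_le_trans t0.
  have [||d1 d2] := @continuous_FTC1_closed R gam c t m tm gami _ _ => //.
    by apply: cgam; [exact/ec/ltW|exact/lta/ltW].
  by split => //; rewrite -derive1E.
exists (fun t => P t - P 0), gam, dgam => t t0 tM.
have tm : t < m by exact: le_lt_trans Mm.
have ta := lta t (ltW tm).
have et : - eta < t by apply: ec; exact: le_trans (ltW c0) t0.
have Dt : nl_domain a t by split.
have gE s : 0 <= s -> (s%:E < a)%E -> gam s = (F s)^-1.
  by move=> s0 sa; rewrite /gam FeF.
split.
- have Dc := is_derive_cst (P 0) t (1 : R).
  by have := is_deriveB (PD t t0 tM) Dc; rewrite subr0.
- exact: gamD.
- exact: cdgam.
- split; first exact: gE.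
  by rewrite /dgam mulNr oppr_le0 mulr_ge0 ?F1_ge0// invr_ge0 sqr_ge0.
have gamti : mu.-integrable `[c, t] (EFin \o gam).
  apply: integrableS gami => //; apply: subset_itvl; rewrite bnd_simp; exact: ltW.
have PE : P t - P 0 = \int[mu]_(x in `]0, t]) gam x.
  by rewrite /P Rintegral_itvB// bnd_simp// ltW.
have gam0 x : `]0, t]%classic x -> 0 <= gam x.
  rewrite /= in_itv/= => /andP[x0 xt].
  rewrite invr_ge0 ltW// Fe0//.
    by apply: ec; rewrite ltW// (lt_trans c0).
  by apply: lta; exact: le_trans xt (ltW tm).
split; first by rewrite PE; exact: Rintegral_ge0.
have g0ti : mu.-integrable `]0, t] (EFin \o gam).
  apply: integrableS gamti => //.
  by apply: subset_itvr; rewrite bnd_simp ltW.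
rewrite PE /Rintegral fineK; last exact: integrable_fin_num.
rewrite /C_F.
have oI := open_nl_interior a0.
have -> : (\int[mu]_(x in nl_interior a) ((F x)^-1)%:E =
    \int[mu]_(x in nl_interior a) (gam x)%:E)%E.
  by apply: eq_integral => x /set_mem[x0 xa]; rewrite gE// ltW.
apply: ge0_subset_integral => //=.
- exact: open_measurable.
- apply/measurable_EFinP; apply: open_continuous_measurable_fun => //.
  move=> x /set_mem[x0 xa]; apply: cgam => //.
  by apply: ec; rewrite ltW// (lt_trans c0).
- move=> x [x0 xa]; rewrite lee_fin gE ?ltW// invr_gt0.
  by rewrite (lt_le_trans ltr01)// (nonlinearity_ge1 nF)//; split => //; exact: ltW.
- move=> x /=; rewrite in_itv/= => /andP[x0 xt]; split => //.
  by apply: lta; exact: le_trans xt (ltW tm).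
Qed.

Lemma C_F_ge0 a F : nonlinearity a F -> (0 <= C_F a F)%E.
Proof.
move=> nF; apply: integral_ge0 => x [x0 xa].
rewrite lee_fin invr_ge0 (le_trans ler01)// (nonlinearity_ge1 nF)//.
by split => //; exact: ltW.
Qed.

End reciprocal_primitive.

(** * The normalized first eigenfunction *)

Section eigenfunction_test.
Context {R : realType} {n : nat}.
Local Notation rV := 'rV[R]_n.
Local Notation mu := (@lebesgue_rV R n).
Local Notation e i := (delta_mx ord0 i : rV).
Variable Omega : set rV.
Hypotheses (oO : open Omega) (bO : bounded_set Omega).

Let mO : measurable Omega. Proof. exact: open_measurable_rV. Qed.

Lemma open_norm_lt (x : rV) : Omega x ->
  exists2 r : R, 0 < r & forall y, `|x - y| < r -> Omega y.
Proof.
move=> Ox; have := open_nbhs_nbhs (conj oO Ox).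
rewrite -nbhs_ballE => -[r /= r0 rO]; exists r => // y xy; apply: rO.
by rewrite -ball_normE.
Qed.

Lemma holder_continuous_at (f : rV -> R) (x : rV) : holder_continuous Omega f ->
  Omega x -> {for x, continuous f}.
Proof.
move=> [al [c [al0 _ Hf]]] Ox; apply: epsilon_continuous_at => eps eps0.
have [r r0 rO] := open_norm_lt Ox.
have c0 : 0 < `|c| + 1 by rewrite ltr_wpDl.
pose q := eps / (`|c| + 1); have q0 : 0 < q by rewrite divr_gt0.
exists (Num.min r (q `^ al^-1)); first by rewrite lt_min r0 powR_gt0.
move=> y; rewrite lt_min => /andP[xyr xyq].
have Oy := rO y xyr.
apply: le_lt_trans (Hf x y Ox Oy) _.
have H1 : `|x - y| `^ al < q.
  have := gt0_ltr_powR al0 (normr_ge0 (x - y)) (powR_ge0 q al^-1) xyq.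
  by rewrite -powRrM mulVf ?gt_eqF// powRr1// ltW.
apply: (@le_lt_trans _ _ ((`|c| + 1) * `|x - y| `^ al)).
  by apply: ler_wpM2r; [exact: powR_ge0|rewrite (le_trans (ler_norm c))// lerDl].
by rewrite mulrC -ltr_pdivlMr.
Qed.

Variable phi : rV -> R.
Hypotheses (hphi : normalized_first_eigenfunction Omega phi).
Let l := lambda1 Omega.

Let mphi : measurable_fun Omega phi.
Proof. by case: hphi => -[G [mphi _ _] _]. Qed.

Lemma mean_eigenfunction : \int[mu]_(x in Omega) phi x = 1.
Proof. by case: hphi => _ _; rewrite /Rintegral => ->. Qed.

Let L2phi : L2 Omega phi.
Proof. by case: hphi => -[G /(H10_L2 oO bO)[]]. Qed.

Lemma Rintegral_mul_norm (b : rV -> R) : measurable_fun Omega b ->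
  \int[mu]_(x in Omega) (b x * `|phi x|) = \int[mu]_(x in Omega) (b x * phi x).
Proof.
move=> mb; rewrite /Rintegral; congr fine; apply: ae_eq_integral => //.
- apply/measurable_EFinP; apply: measurable_funM => //.
  exact: measurableT_comp.
- by apply/measurable_EFinP; exact: measurable_funM.
have [_ phi0 _] := hphi.
by apply: filterS phi0 => x phi0 Ox; rewrite ger0_norm// ltW// phi0.
Qed.

(** Otherwise f phi, hence f, would vanish almost everywhere, whereas f is
    positive on a ball around x0 and balls have positive measure. *)
Lemma Rintegral_mul_gt0 (f : rV -> R) (x0 : rV) : L2 Omega f ->
  (forall x, Omega x -> 0 <= f x) -> Omega x0 -> {for x0, continuous f} ->
  f x0 != 0 -> 0 < \int[mu]_(x in Omega) (f x * phi x).
Proof.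
move=> L2f f_ge0 Ox0 cf fx0; have [mf _] := L2f.
rewrite -Rintegral_mul_norm//.
have I0 : 0 <= \int[mu]_(x in Omega) (f x * `|phi x|).
  by apply: Rintegral_ge0 => x Ox; rewrite mulr_ge0// f_ge0.
rewrite lt_neqAle I0 andbT; apply/negP => /eqP /esym I00.
have fi := L2M oO L2f (L2_norm oO L2phi).
have mfphi : measurable_fun Omega (EFin \o (fun x => f x * `|phi x|)).
  exact: measurable_int fi.
have : (\int[mu]_(x in Omega) `|(f x * `|phi x|)%:E| = 0)%E.
  under eq_integral.
    move=> x /set_mem Ox; rewrite gee0_abs; last first.
      by rewrite lee_fin mulr_ge0// f_ge0.
    over.
  have : (\int[mu]_(x in Omega) (f x * `|phi x|)%:E)%E \is a fin_num.
    exact: integrable_fin_num.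
  by move: I00; rewrite /Rintegral => + /fineK => ->.
move/(ae_eq_integral_abs mu mO mfphi) => f0.
have [_ phi_gt0 _] := hphi.
have ae0 : {ae mu, forall x, Omega x -> f x = 0}.
  apply: filterS2 f0 phi_gt0 => x /= f0 phi_gt0 Ox.
  have := f0 Ox; case => /eqP; rewrite mulf_eq0 => /orP[/eqP //|].
  by rewrite normr_eq0 gt_eqF// phi_gt0.
have [r r0 rO] := open_norm_lt Ox0.
have fx0_gt0 : 0 < f x0 by rewrite lt0r fx0 f_ge0.
have cfx : f y @[y --> x0] --> f x0 by exact: cf.
move/cvgrPdist_lt : cfx => /(_ _ fx0_gt0).
rewrite -nbhs_ballE => -[s /= s0 Hs].
pose t := Num.min r s.
have t0 : 0 < t by rewrite lt_min r0.
have [N [mN N0 HN]] := ae0.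
have : (mu (ball x0 t) <= mu N)%E.
  apply: le_measure; rewrite ?inE//; first exact: measurable_ball_rV.
  move=> y xy; apply: HN => /=.
  have Oy : Omega y.
    by apply: rO; move: xy; rewrite -ball_normE /ball_ /= lt_min => /andP[].
  move=> /(_ Oy) fy0.
  have /Hs : ball x0 s y by apply: le_ball xy; rewrite ge_min lexx orbT.
  by rewrite fy0 subr0 gtr0_norm// ltxx.
by rewrite N0 leNgt lebesgue_rV_ball_gt0.
Qed.

End eigenfunction_test.

(** * The two bounds on lambda *)

Section classical_solution_bounds.
Context {R : realType} {n : nat}.
Local Notation rV := 'rV[R]_n.
Local Notation mu := (@lebesgue_rV R n).
Local Notation e i := (delta_mx ord0 i : rV).
Variable Omega : set rV.
Hypotheses (oO : open Omega) (bO : bounded_set Omega) (nO : Omega !=set0).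
Variables (f : rV -> R) (a : \bar R) (F : R -> R) (phi : rV -> R).
Hypotheses (f_ge0 : forall x, Omega x -> 0 <= f x)
  (f_neq0 : exists2 x, Omega x & f x != 0)
  (f_bounded : [bounded f x | x in Omega])
  (f_holder : holder_continuous Omega f)
  (nF : nonlinearity a F) (a0 : (0 < a)%E)
  (hphi : normalized_first_eigenfunction Omega phi).
Variables (lam : R) (u : rV -> R).
Hypotheses (lam0 : 0 < lam) (hu : classical_solution Omega f a F lam u).
Local Notation l1 := (lambda1 Omega).

Let mO : measurable Omega. Proof. exact: open_measurable_rV. Qed.

Let iphi := mean_eigenfunction hphi.

Let pphi : dirichlet_eigenpair Omega l1 phi. Proof. by case: hphi. Qed.

Let l1_ge0 : 0 <= l1. Proof. exact: eigenpair_ge0 oO bO _ _ pphi iphi. Qed.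

Let L2phi : L2 Omega phi.
Proof. by case: pphi => G /(H10_L2 oO bO)[]. Qed.

Let uD x : Omega x -> nl_domain a (u x).
Proof. by case: hu => -[_ _ H _ _] _; exact: H. Qed.

Let u_ge0 x : Omega x -> 0 <= u x. Proof. by move=> /uD[]. Qed.

Let cu x : Omega x -> {for x, continuous u}.
Proof. by move=> Ox; case: hu => -[/(_ [::] x isT Ox)[]]. Qed.

Let cdu i x : Omega x -> {for x, continuous (partial i u)}.
Proof. by move=> Ox; case: hu => -[/(_ [:: i] x isT Ox)[]]. Qed.

Let cd2u i x : Omega x -> {for x, continuous (partials [:: i; i] u)}.
Proof. by move=> Ox; case: hu => -[/(_ [:: i; i] x isT Ox)[]]. Qed.

Let ud i x : Omega x -> is_derive x (e i) u (partial i u x).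
Proof.
move=> Ox; apply: is_derive_partial.
by case: hu => -[/(_ [::] x isT Ox)[_ /(_ isT)]].
Qed.

Let dud i x : Omega x -> is_derive x (e i) (partial i u) (partials [:: i; i] u x).
Proof.
move=> Ox; apply: is_derive_partial.
by case: hu => -[/(_ [:: i] x isT Ox)[_ /(_ isT)]].
Qed.

Let equ x : Omega x -> - laplacian u x = lam * f x * F (u x).
Proof. by case: hu => -[_ _ _ H _] _; exact: H. Qed.

Let bound_u : exists2 M : R, 0 <= M /\ (M%:E < a)%E & forall x, Omega x -> u x <= M.
Proof.
have [_ sup_lt] := hu; set s := ereal_sup _ in sup_lt.
have us x : Omega x -> ((u x)%:E <= s)%E.
  move=> Ox; apply: (@le_trans _ _ (`|u x|%:E)); first by rewrite lee_fin ler_norm.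
  by apply: ereal_sup_ubound; exists x.
have [x0 Ox0] := nO.
have s0 : (0 <= s)%E by apply: le_trans (us x0 Ox0); rewrite lee_fin u_ge0.
have sfin : s \is a fin_num.
  by rewrite ge0_fin_numE//; apply: lt_le_trans sup_lt _; exact: leey.
exists (fine s); first by rewrite fine_ge0// fineK.
by move=> x Ox; rewrite -lee_fin fineK// us.
Qed.

Let F_ge1 t : nl_domain a t -> 1 <= F t. Proof. exact: nonlinearity_ge1. Qed.

Let cf x : Omega x -> {for x, continuous f}.
Proof. exact: holder_continuous_at. Qed.

Let mf : measurable_fun Omega f.
Proof. exact: open_continuous_measurable_rV. Qed.

Let bound_f : exists Mf, forall x, Omega x -> f x <= Mf.
Proof.
have [M [_ HM]] := f_bounded; exists (`|M| + 1) => x Ox.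
by rewrite (le_trans (ler_norm _))//; apply: HM => //; rewrite ltr_pwDr// ler_norm.
Qed.

Let L2f : L2 Omega f.
Proof.
have [M HM] := bound_f; apply: (L2_bounded oO bO (M := M)) => // x Ox.
by rewrite ger0_norm ?f_ge0// HM.
Qed.

Let If := \int[mu]_(x in Omega) (f x * phi x).

Let If_gt0 : 0 < If.
Proof.
have [x0 Ox0 fx0] := f_neq0.
by apply: (Rintegral_mul_gt0 oO bO hphi) fx0 => //; exact: cf.
Qed.

(** Take v = g (u) with g' = 1 / F: its Laplacian satisfies
    - Delta v = lam f + (F' / F^2) (u) |du|^2 >= lam f. *)
Lemma primitive_test : exists v : rV -> R, [/\ measurable_fun Omega v,
    forall x, Omega x -> 0 <= v x,
    forall x, Omega x -> ((v x)%:E <= C_F a F)%E, L2 Omega v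
    & lam * If <= l1 * \int[mu]_(x in Omega) (v x * `|phi x|)].
Proof.
have [M [M0 Ma] uM] := bound_u.
have [g [gam [dgam Hg]]] := primitive_reciprocal nF M0 Ma.
have gu x : Omega x -> _ := fun Ox => Hg (u x) (u_ge0 Ox) (uM x Ox).
pose v x := g (u x).
pose dv i x := gam (u x) * partial i u x.
pose d2v i x := gam (u x) * partials [:: i; i] u x +
  partial i u x * (dgam (u x) * partial i u x).
have cg1 (h dh : R -> R) x : Omega x -> is_derive (u x) (1 : R) h (dh (u x)) ->
    {for x, continuous (fun y => h (u y))}.
  move=> Ox hd; have ch : {for u x, continuous h}.
    by apply: differentiable_continuous; apply/derivable1_diffP; case: hd.
  exact: continuous_comp (cu Ox) ch.
have cv x : Omega x -> {for x, continuous v}.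
  by move=> Ox; have [gd _ _ _ _] := gu x Ox; exact: cg1 gd.
have cgam x : Omega x -> {for x, continuous (fun y => gam (u y))}.
  by move=> Ox; have [_ gd _ _ _] := gu x Ox; exact: cg1 gd.
have cdgam x : Omega x -> {for x, continuous (fun y => dgam (u y))}.
  by move=> Ox; have [_ _ cd _ _] := gu x Ox; exact: continuous_comp (cu Ox) cd.
have mv : measurable_fun Omega v by exact: open_continuous_measurable_rV.
have v0 x : Omega x -> 0 <= v x by move=> Ox; have [_ _ _ _ []] := gu x Ox.
have vB x : Omega x -> v x <= g M.
  move=> Ox; have H0 := u_ge0 Ox; have HM := uM x Ox.
  have gD t : u x <= t -> t <= M -> is_derive t (1 : R) g (gam t).
    by move=> ut tM; have [] := Hg t (le_trans H0 ut) tM.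
  have [||c] := @MVT_segment _ g gam (u x) M HM.
  - by move=> t; rewrite in_itv/= => /andP[ut tM]; apply: gD; exact: ltW.
  - apply: continuous_in_subspaceT => t /set_mem /=; rewrite in_itv/= => /andP[ut tM].
    by apply: differentiable_continuous; apply/derivable1_diffP; case: (gD t ut tM).
  rewrite in_itv/= => /andP[uc cM] E; rewrite /v -subr_ge0 E.
  have [_ _ _ [-> _] _] := Hg c (le_trans H0 uc) cM.
  rewrite mulr_ge0 ?subr_ge0// invr_ge0 (le_trans ler01)// F_ge1//.
  by split; [exact: le_trans uc|apply: le_lt_trans Ma; rewrite lee_fin].
have [Mf HMf] := bound_f.
exists v; split => //.
- by move=> x Ox; have [_ _ _ _ []] := gu x Ox.
- apply: (L2_bounded oO bO (M := g M)) => // x Ox.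
  by rewrite ger0_norm ?v0// vB.
rewrite /If -RintegralZl//; last exact: (L2M oO L2f L2phi).
under eq_Rintegral do rewrite mulrA.
apply: (superharmonic_test oO bO l1_ge0 pphi iphi (v := v) (dv := dv) (d2v := d2v)
  (C := g M) (h := fun x => lam * f x) (H := lam * Mf)) => //.
- move=> i x Ox; exact: (continuousM (cgam x Ox) (cdu (i := i) Ox)).
- move=> i x Ox.
  have c1 := continuousM (cgam x Ox) (cd2u (i := i) Ox).
  have c2 := continuousM (cdu (i := i) Ox) (continuousM (cdgam x Ox) (cdu (i := i) Ox)).
  exact: (continuousD c1 c2).
- by move=> i x Ox; have [gd _ _ _ _] := gu x Ox; exact: is_derive_comp1 (ud i Ox) gd.
- move=> i x Ox; have [_ gd _ _ _] := gu x Ox.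
  have Dg := is_derive_comp1 (ud i Ox) gd.
  exact: (is_deriveM Dg (dud i Ox)).
- by apply: measurable_funM.
- by move=> x Ox; rewrite mulr_ge0 ?f_ge0// ltW.
- by move=> x Ox; rewrite ler_wpM2l ?HMf// ltW.
- move=> x Ox; have [_ _ _ [gF dg0] _] := gu x Ox.
  have Fu0 : 0 < F (u x) by rewrite (lt_le_trans ltr01)// F_ge1//; exact: uD.
  rewrite /d2v big_split /= -mulr_sumr -/(laplacian u x) opprD -mulrN equ// gF.
  have -> : (F (u x))^-1 * (lam * f x * F (u x)) = lam * f x by field; rewrite gt_eqF.
  rewrite lerDl oppr_ge0; apply: sumr_le0 => i _.
  by rewrite mulrCA -expr2 mulr_le0_ge0// sqr_ge0.
Qed.

(** If it vanished, primitive_test would give lam * If <= 0. Positivity is what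
    makes the products with +oo in the two bounds infinite. *)
Lemma lambda1_gt0 : 0 < l1.
Proof.
have [v [mv v0 _ L2v Hv]] := primitive_test.
rewrite lt_neqAle l1_ge0 andbT; apply/negP => /eqP l10.
by move: Hv; rewrite -l10 mul0r leNgt mulr_gt0.
Qed.

(** Bound v by C_F in primitive_test; the mean of phi is one. *)
Lemma lambda_le_C_F :
  (lam%:E <= l1%:E * (C_F a F / \int[mu]_(x in Omega) (f x * phi x)%:E))%E.
Proof.
have [v [mv v0 vC L2v Hv]] := primitive_test.
have fphii := L2M oO L2f L2phi.
have -> : (\int[mu]_(x in Omega) (f x * phi x)%:E = If%:E)%E.
  by rewrite /If /Rintegral fineK//; exact: integrable_fin_num.
rewrite (_ : (If%:E)^-1%E = (If^-1)%:E); last by rewrite /inve gt_eqF.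
have C0 := C_F_ge0 nF.
case: (C_F a F) C0 vC => [C||//] C0 vC.
  rewrite -!EFinM lee_fin mulrA ler_pdivlMr//; apply: le_trans Hv _.
  apply: ler_wpM2l => //.
  have -> : C = \int[mu]_(x in Omega) (C * `|phi x|).
    by rewrite (Rintegral_mul_norm oO hphi)// RintegralZl ?iphi ?mulr1//; exact: L2_int.
  apply: le_Rintegral => //.
  - exact: (L2M oO L2v (L2_norm oO L2phi)).
  - by apply: rintegrableZ => //; apply: L2_int => //; exact: L2_norm.
  - by move=> x Ox; rewrite ler_wpM2r// -lee_fin vC.
by rewrite gt0_mulye ?lte_fin ?invr_gt0// gt0_muley ?lte_fin ?lambda1_gt0// leey.
Qed.

(** With m the infimum of f, test with u itself: - Delta u >= lam m F(u), while
    u <= B_F F(u), so lam m and l1 B_F are compared through the same positive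
    integral J. *)
Lemma lambda_le_B_F :
  (lam%:E <= l1%:E * (B_F a F / (inf [set f x | x in Omega])%:E))%E.
Proof.
set m := inf _.
have [x0 Ox0] := nO.
have m0 : 0 <= m.
  by apply: lb_le_inf => [|_ [x Ox <-]]; [exists (f x0); exists x0|exact: f_ge0].
have mf_ x : Omega x -> m <= f x.
  move=> Ox; apply: ge_inf; last by exists x.
  by exists 0 => _ [y Oy <-]; exact: f_ge0.
have [t t0 ta] := real_between a0.
have Dt : nl_domain a t by split => //; exact: ltW.
have B0 : (0 < B_F a F)%E.
  apply: (@lt_le_trans _ _ (t / F t)%:E).
    by rewrite lte_fin divr_gt0// (lt_le_trans ltr01)// F_ge1.
  by apply: ereal_sup_ubound; exists t.
have l1E : (0 < l1%:E)%E by rewrite lte_fin lambda1_gt0.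
have [m_eq0|m_neq0] := eqVneq m 0.
  by rewrite m_eq0 /inve eqxx gt0_muley// gt0_muley// leey.
have m_gt0 : 0 < m by rewrite lt0r m_neq0.
rewrite (_ : (m%:E)^-1%E = (m^-1)%:E); last by rewrite /inve (negbTE m_neq0).
case E : (B_F a F) B0 => [B||//] B0; last first.
  by rewrite gt0_mulye ?lte_fin ?invr_gt0// gt0_muley// leey.
have uB x : Omega x -> u x <= B * F (u x).
  move=> Ox; have Du := uD Ox.
  have F0 : 0 < F (u x) by rewrite (lt_le_trans ltr01)// F_ge1.
  have [->|ux0] := eqVneq (u x) 0.
    rewrite mulr_ge0//; first by move: B0; rewrite lte_fin => /ltW.
    by rewrite (le_trans ler01)// F_ge1//; split.
  rewrite -ler_pdivrMr// -lee_fin -E; apply: ereal_sup_ubound; exists (u x) => //.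
  by split; [rewrite lt0r ux0 u_ge0|case: Du].
have [M [M0 Ma] uM] := bound_u.
have FM x : Omega x -> F (u x) <= F M.
  move=> Ox; case: nF => _ homF _ _; apply: homF; rewrite ?inE//; [exact: uD|exact: uM].
have [Fe [F1 [FeF _ FeD _ _]]] := nonlinearity_extension nF a0.
have mFu : measurable_fun Omega (fun x => F (u x)).
  apply: (@eq_measurable_fun _ _ _ _ _ (fun x => Fe (u x))).
    by move=> x /set_mem Ox; rewrite FeF//; exact: uD.
  apply: open_continuous_measurable_rV => // x Ox.
  have cFe : {for u x, continuous Fe}.
    apply: differentiable_continuous; apply/derivable1_diffP.
    by case: (FeD (u x) (uD Ox).2).
  exact: continuous_comp (cu Ox) cFe.
have F_gt0 x : Omega x -> 0 < F (u x).
  by move=> Ox; rewrite (lt_le_trans ltr01)// F_ge1//; exact: uD.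
have L2F : L2 Omega (fun x => F (u x)).
  apply: (L2_bounded oO bO (M := F M)) => // x Ox.
  by rewrite ger0_norm ?FM// ltW// F_gt0.
have L2u : L2 Omega u.
  apply: (L2_bounded oO bO (M := M)); first exact: open_continuous_measurable_rV.
  by move=> x Ox; rewrite ger0_norm ?u_ge0// uM.
have L2aphi := L2_norm oO L2phi.
pose J := \int[mu]_(x in Omega) (F (u x) * `|phi x|).
have J0 : 0 < J.
  apply: (@lt_le_trans _ _ (\int[mu]_(x in Omega) (1 * `|phi x|))).
    rewrite (Rintegral_mul_norm oO hphi)//.
    by under eq_Rintegral do rewrite mul1r; rewrite iphi.
  apply: le_Rintegral => //; [|exact: (L2M oO L2F L2aphi)|].
    by apply: rintegrableZ => //; exact: L2_int.
  by move=> x Ox; rewrite ler_wpM2r// F_ge1//; exact: uD.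
have Hmain : \int[mu]_(x in Omega) (lam * m * F (u x) * phi x) <=
    l1 * \int[mu]_(x in Omega) (u x * `|phi x|).
  apply: (superharmonic_test oO bO l1_ge0 pphi iphi (v := u) (dv := fun i => partial i u)
    (d2v := fun i => partials [:: i; i] u) (C := M) (h := fun x => lam * m * F (u x))
    (H := lam * m * F M)) => //.
  - by apply: measurable_funM.
  - by move=> x Ox; rewrite !mulr_ge0// ltW// F_gt0.
  - by move=> x Ox; rewrite ler_wpM2l ?FM// mulr_ge0// ltW.
  - move=> x Ox; rewrite -/(laplacian u x) equ//.
    rewrite ler_wpM2r ?(ltW (F_gt0 x Ox))// ler_wpM2l ?mf_//; exact: ltW.
have Hu : \int[mu]_(x in Omega) (u x * `|phi x|) <= B * J.
  rewrite /J -RintegralZl//; last exact: (L2M oO L2F L2aphi).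
  apply: le_Rintegral => //; first exact: (L2M oO L2u L2aphi).
    by apply: rintegrableZ => //; exact: (L2M oO L2F L2aphi).
  by move=> x Ox; rewrite mulrA ler_wpM2r// uB.
have HJ : \int[mu]_(x in Omega) (lam * m * F (u x) * phi x) = lam * m * J.
  rewrite /J (Rintegral_mul_norm oO hphi)// -RintegralZl//;
    last exact: (L2M oO L2F L2phi).
  by apply: eq_Rintegral => x _; rewrite !mulrA.
rewrite -!EFinM lee_fin mulrA ler_pdivlMr// -(ler_pM2r J0) -HJ.
by rewrite (le_trans Hmain)// -mulrA ler_wpM2l.
Qed.

End classical_solution_bounds.

Theorem proposition2p1 (R : realType) (N : nat) (hN : (0 < N)%N)
    (Omega : set 'rV[R]_N) (hOmega : smooth_bounded_domain Omega)
    (f : 'rV[R]_N -> R)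
    (f_ge0 : forall x, Omega x -> 0 <= f x)
    (f_neq0 : exists2 x, Omega x & f x != 0)
    (f_bounded : [bounded f x | x in Omega])
    (f_holder : holder_continuous Omega f)
    (a : \bar R) (F : R -> R) (hF : regular a F \/ singular a F)
    (phi : 'rV[R]_N -> R) (hphi : normalized_first_eigenfunction Omega phi) :
  (lambda_star Omega f a F <=
   (lambda1 Omega)%:E *
   Order.min (B_F a F / (inf [set f x | x in Omega])%:E)
             (C_F a F / \int[lebesgue_rV N]_(x in Omega) (f x * phi x)%:E))%E.
Proof.
have [oO nO _ bO _] := hOmega.
have [nF a0] : nonlinearity a F /\ (0 < a)%E.
  by case: hF => -[nF aE _]; split => //; rewrite aE ?lte01.
apply: ge_ereal_sup => _ [lam [lam0 [u hu]] <-].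
rewrite /Order.min; case: ifP => _.
- exact: (lambda_le_B_F oO bO nO f_ge0 f_neq0 f_bounded f_holder nF a0 hphi lam0 hu).
- exact: (lambda_le_C_F oO bO nO f_ge0 f_neq0 f_bounded f_holder nF hphi lam0 hu).
Qed.
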